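(* Let $r\ge1$ and let $\mathbf{a}=(a_1,\ldots,a_{r+1})$ be positive integers with $a_{r+1}\ge 2$, either all even or with exactly two odd coordinates, one of which is $a_{r+1}$; let $\tilde{\mathbf{a}}:=(a_1+1,a_2,\ldots,a_r,a_{r+1}-1)$. Let $\mathcal{M}$ be the set of triples $(\mathfrak{m};c,h')$ where $\mathfrak{m}$ is a map of type $\mathbf{a}$, $c$ is a distinguished corner of $f_1$, and $h'$ is a half-edge incident to $f_{r+1}$ directed toward $c$. Let $\tilde{\mathcal{M}}$ be the set of triples $(\tilde{\mathfrak{m}};c',h)$ where $\tilde{\mathfrak{m}}$ is a map of type $\tilde{\mathbf{a}}$, $c'$ is a distinguished corner of $f_{r+1}$, and $h$ is a half-edge incident to $f_1$ directed away from $c'$. Define $\Phi_{\mathrm{left}}$ on $\mathcal{M}$: given $(\mathfrak{m};c,h')$, let $h'_0$ be the corner delimited by $h'$ and its predecessor in the contour of $f_{r+1}$, and let $\mathbbm{h}'$ be the leftmost geodesic from $h'_0$ to $c$. Slit $\mathfrak{m}$ along $\mathbbm{h}'$ from $h'_0$ to $c$, let $\mathbbm{l}',\mathbbm{r}'$ be the left and right copies of $\mathbbm{h}'$, and sew $\mathbbm{l}'_{2\to[\mathbbm{h}']}$ onto $\mathbbm{r}'_{1\to[\mathbbm{h}']-1}$. In the result, let $h:=\mathbbm{r}'_{[\mathbbm{h}']}$, delete the dangling edge $\mathbbm{l}'_1$ and let $c'$ be the corner it leaves; calling $\tilde{\mathfrak{m}}$ the resulting map, set $\Phi_{\mathrm{left}}(\mathfrak{m};c,h'):=(\tilde{\mathfrak{m}};c',h)$.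 Define $\Phi_{\mathrm{right}}$ on $\tilde{\mathcal{M}}$: given $(\tilde{\mathfrak{m}};c',h)$, let $h_0$ be the corner delimited by $h$ and its successor in the contour of $f_1$, and let $\mathbbm{h}$ be the rightmost geodesic from $h_0$ to $c'$. Slit $\tilde{\mathfrak{m}}$ along $\mathbbm{h}$ from $h_0$ to $c'$, let $\mathbbm{l},\mathbbm{r}$ be the left and right copies of $\mathbbm{h}$, and sew $\mathbbm{l}_{1\to[\mathbbm{h}]-1}$ onto $\mathbbm{r}_{2\to[\mathbbm{h}]}$. In the result, let $h':=\operatorname{rev}(\mathbbm{l})_1$, delete the dangling edge $\mathbbm{r}_1$ and let $c$ be the corner it leaves; calling $\mathfrak{m}$ the resulting map, set $\Phi_{\mathrm{right}}(\tilde{\mathfrak{m}};c',h):=(\mathfrak{m};c,h')$. Then $\Phi_{\mathrm{left}}:\mathcal{M}\to\tilde{\mathcal{M}}$ and $\Phi_{\mathrm{right}}:\tilde{\mathcal{M}}\to\mathcal{M}$ are well-defined and are inverse bijections.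
   Context: A plane map is an embedding of a finite connected graph (multiple edges and loops allowed) into the sphere, up to orientation-preserving homeomorphisms. A map of type $(a_1,\ldots,a_k)$ is a plane map with faces numbered $f_1,\ldots,f_k$, $f_i$ of degree $a_i$, each face carrying one marked corner. Distinguishing a corner splits it into two corners (so a face of degree $a$ with its marked corner has $a+1$ corners available for distinguishing). A half-edge $h$ is an oriented edge with origin $h^-$, end $h^+$ and reverse $\operatorname{rev}(h)$; a corner is viewed as a half-edge with no origin whose end $c^+$ is the vertex of the corner. A half-edge is incident to a face if it lies on its boundary with the face to its left. A path is a sequence $\mathbbm{p}=(\mathbbm{p}_1,\ldots,\mathbbm{p}_\ell)$ of half-edges with $\mathbbm{p}_k^+=\mathbbm{p}_{k+1}^-$, of length $[\mathbbm{p}]=\ell$; $\mathbbm{p}_{i\to j}=(\mathbbm{p}_i,\ldots,\mathbbm{p}_j)$ (empty if $i>j$); $\operatorname{rev}(\mathbbm{p})=(\operatorname{rev}(\mathbbm{p}_\ell),\ldots,\operatorname{rev}(\mathbbm{p}_1))$. Distances are graph distances $d$; a half-edge $h$ is directed toward (resp. away from) a vertex or corner $v$ if $d(h^+,v)<d(h^-,v)$ (resp. $>$), using the vertex of the corner. The leftmost geodesic from a half-edge or corner $h$ to a vertex or corner: consider all geodesics from $h^+$ to the target vertex, take the set of their first steps, and, turning clockwise around $h^+$ starting from $h$, select the first half-edge of this set met (possibly $\operatorname{rev}(h)$); iterate from this half-edge until the target is reached (the path may be empty). The rightmost geodesic is defined symmetrically turning counterclockwise. Slitting a map along a self-avoiding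 path $\mathbbm{p}$ from a corner $c$ (with $c^+=\mathbbm{p}_1^-$) to a corner $c'$ (with $c'^+$ its final vertex) means cutting open along $\mathbbm{p}$, doubling each of its edges, the cut entering at $c$ and exiting at $c'$; this yields two copies of $\mathbbm{p}$, the left copy $\mathbbm{l}$ (bordering the region to the left of $\mathbbm{p}$) and the right copy $\mathbbm{r}$. Sewing $\mathbbm{l}_{i\to j}$ onto $\mathbbm{r}_{i'\to j'}$ (same length) means identifying $\mathbbm{l}_{i+k}$ with $\mathbbm{r}_{i'+k}$ for each $k$. Marked corners of faces are carried along by the construction. *)

(* Defs.v *)
From HB Require Import structures.
From mathcomp Require Import all_boot.

Set Implicit Arguments.
Unset Strict Implicit.
Unset Printing Implicit Defensive.

(* Maps are encoded by permutations.  The elements of a map are its half-edges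
   together with its marked corners, a marked corner being a half-edge without
   origin.  [rv] reverses half-edges and fixes marked corners; [nxt] is the
   successor in the contour of the face lying to the left, where a marked
   corner occupies its own place in the contour; [lab] gives the number of the
   face of a marked corner (None on half-edges).

   A corner available for distinguishing is encoded by an element x and is the
   one delimited by x and its predecessor for [nxt]; so a face of degree a,
   carrying its marked corner, has exactly a + 1 of them.  Both the origin of x
   and the vertex of the corner x are the [cw]-orbit of x; the end of x is the
   [cw]-orbit of [rv x]. *)
Record premap (k : nat) := Premap {
  elt :> finType;
  rv : elt -> elt;
  nxt : elt -> elt;
  lab : elt -> option 'I_k }.

Arguments rv {k p} _.
Arguments nxt {k p} _.
Arguments lab {k p} _.

Section Maps.
Variables (k : nat) (m : premap k).
Implicit Types (x y t h : m) (p : seq m) (i : 'I_k).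

Definition half_edge x := rv x != x.

(* As faces lie to the left, the half-edge following [rv h] clockwise around
   the end of h is [nxt h]. *)
Definition cw x : m := nxt (rv x).

Definition same_vertex x y := fconnect cw x y.

Fixpoint walk x p y : bool :=
  if p is h :: q then
    [&& half_edge h, same_vertex x h & walk (rv h) q y]
  else same_vertex x y.

(* #|m| when there is no walk; no shortest walk is that long. *)
Definition dist x y : nat :=
  find (fun n => [exists p : n.-tuple m, walk x p y]) (iota 0 #|m|).

Definition toward h t := dist (rv h) t < dist h t.
Definition away h t := dist h t < dist (rv h) t.

Definition in_face i x := [exists y, (lab y == Some i) && fconnect nxt y x].

Definition degree i := #|[set x | in_face i x && half_edge x]|.

Definition connected := forall x y, exists p, walk x p y.

(* Euler's formula for the sphere: V + F = E + 2. *)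
Definition planar :=
  fcard cw m + fcard nxt m = #|[set x : m | half_edge x]|./2 + 2.

Definition is_map (a : 'I_k -> nat) : Prop :=
  [/\ [/\ involutive (@rv k m), injective (@nxt k m) &
          forall x, half_edge x = (lab x == None)],
      [/\ forall i, exists! x, lab x = Some i &
          forall x, exists! y, lab y <> None /\ fconnect nxt y x],
      connected,
      planar &
      forall i, degree i = a i].

Definition geodesic x p t := walk x p t && (size p == dist x t).

Definition first_step x t h :=
  [exists p : (dist x t).-tuple m, geodesic x p t && (ohead p == Some h)].

(* From the corner x, the elements met turning clockwise are x, cw x, ...; from
   a half-edge h one turns around its end starting just after [rv h], that is
   from the corner [nxt h].  Marked corners are never first steps. *)
Fixpoint leftmost_rec n x t : seq m :=
  if n is n'.+1 then
    let s := orbit cw x in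
    let h := nth x s (find (first_step x t) s) in
    h :: leftmost_rec n' (nxt h) t
  else [::].

Definition leftmost x t := leftmost_rec (dist x t) x t.

(* From the corner x, the elements met turning counterclockwise are those of
   the [cw]-orbit backwards, ending with x; from a half-edge h one ends with
   [rv h], that is one starts from the corner [rv h]. *)
Fixpoint rightmost_rec n x t : seq m :=
  if n is n'.+1 then
    let s := orbit (finv cw) (finv cw x) in
    let h := nth x s (find (first_step x t) s) in
    h :: rightmost_rec n' (rv h) t
  else [::].

Definition rightmost x t := rightmost_rec (dist x t) x t.

Definition self_avoiding x p := uniq (map (froot cw) (x :: map rv p)).

Definition rev_path p : seq m := rev (map rv p).

End Maps.

(* p_{i -> j}, with indices starting from 1. *)
Definition subpath (T : Type) (p : seq T) (i j : nat) := drop i.-1 (take j p).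

(* Removal of a list of elements, which are skipped in the contours. *)
Section Remove.
Variables (k : nat) (m : premap k) (s : seq m).

Definition kept : finType := {x : m | x \notin s}.

Definition skip (x : m) : m :=
  let o := traject nxt (nxt x) #|m| in nth x o (find (fun y => y \notin s) o).

Definition remove : premap k :=
  @Premap k kept (fun x => insubd x (rv (val x)))
                 (fun x => insubd x (skip (val x)))
                 (fun x => lab (val x)).

End Remove.

(* Slitting m along p = (p_1, ..., p_l) from the corner e to the corner f.  The
   two lips of the slit are made of 2 l new half-edges, bordering the slit:
   [rlip i] is r_{i+1}, and [llip i] is rev(l_{i+1}).  The half-edges l_{i+1}
   and rev(r_{i+1}) border the former faces to the left and to the right of p:
   they are the former p_{i+1} and rev(p_{i+1}). *)
Section Slit.
Variables (k : nat) (m : premap k) (e f : m) (p : seq m).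

Definition slit_elt : finType := (m + ('I_(size p) + 'I_(size p)))%type.

Definition old (x : m) : slit_elt := inl x.
Definition llip (i : 'I_(size p)) : slit_elt := inr (inl i).
Definition rlip (i : 'I_(size p)) : slit_elt := inr (inr i).

(* The corner of the slit at the left (resp. right) copy of the j-th vertex of
   p, for 0 <= j <= l.  The slit is bordered by
   rlip 0, ..., rlip (l-1), then f, and by llip (l-1), ..., llip 0, then e. *)
Definition lcorner (j : nat) : slit_elt :=
  if j is i.+1 then (if insub i is Some i' then llip i' else old e) else old e.
Definition rcorner (j : nat) : slit_elt :=
  if insub j is Some i then rlip i else old f.

Definition slit_rv (z : slit_elt) : slit_elt :=
  match z with
  | inl x => if insub (index x p) is Some i then llip i
             else if insub (index (rv x) p) is Some i then rlip i
             else old (rv x)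
  | inr (inl i) => old (tnth (in_tuple p) i)
  | inr (inr i) => old (rv (tnth (in_tuple p) i))
  end.

Definition slit_nxt (z : slit_elt) : slit_elt :=
  match z with
  | inl x => if nxt x == e then rcorner 0
             else if nxt x == f then lcorner (size p)
             else old (nxt x)
  | inr (inl i) => lcorner i
  | inr (inr i) => rcorner i.+1
  end.

Definition slit : premap k :=
  @Premap k slit_elt slit_rv slit_nxt
    (fun z => if z is inl x then lab x else None).

Definition left_copy : seq slit := map old p.
Definition right_copy : seq slit := map rlip (enum 'I_(size p)).

(* Sewing l_{i -> j} onto r_{i' -> j'}.  The initial vertices of the two paths
   are identified by exchanging the elements following their corners in the
   slit; the half-edges bordering the slit are then zipped together, so that
   the reverse of l_{i+n} becomes rev(r_{i'+n}).  Sewing empty paths amounts to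
   identifying two vertices. *)
Section Sew.
Variables (i j i' j' : nat).

Let u : seq slit := subpath left_copy i j.
Let v : seq slit := subpath right_copy i' j'.
Let cl : slit := lcorner i.-1.
Let cr : slit := rcorner i'.-1.

Definition sew_nxt (z : slit) : slit :=
  if nxt z == cl then cr else if nxt z == cr then cl else nxt z.

Definition sew_rv (z : slit) : slit :=
  if z \in u then rv (nth z v (index z u))
  else if rv z \in v then nth z u (index (rv z) v)
  else rv z.

Definition sewn_lips : seq slit := map rv u ++ v.

Definition sew : premap k :=
  remove (m := @Premap k slit sew_rv sew_nxt (@lab k slit)) sewn_lips.

End Sew.
End Slit.

(* A map with a distinguished corner and a distinguished half-edge. *)
Record triple (k : nat) := Triple {
  tmap :> premap k;
  tcorner : tmap;
  thedge : tmap }.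

Arguments Triple {k tmap} _ _.

(* The half-edge d is an edge dangling from its end: its origin has degree 1. *)
Definition dangling (k : nat) (m : premap k) (d : m) :=
  half_edge d && (cw d == d).

(* Deletes the dangling edge d and distinguishes the corner it leaves together
   with the half-edge h.  Around a dangling edge, the contour reads
   rev(d), d, nxt d, so that skipping rev(d) and d deletes the edge. *)
Definition delete_dangling (k : nat) (m : premap k) (d h : m) :
    option (triple k) :=
  if dangling d then
    match insub (nxt d), insub h with
    | Some c', Some h' =>
        Some (@Triple k (remove [:: d; rv d]) c' h')
    | _, _ => None
    end
  else None.

(* The path can be slit: it is nonempty and self-avoiding, from e to f. *)
Definition slittable (k : nat) (m : premap k) (e f : m) (p : seq m) :=
  [&& p != [::], walk e p f & self_avoiding e p].

(* Both constructions are partial: None means that some step does not make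
   sense. *)
Definition Phi_left (k : nat) (x : triple k) : option (triple k) :=
  let c := tcorner x in
  let h' := thedge x in
  let h'0 := h' in
  let p := leftmost h'0 c in
  let l := size p in
  if slittable h'0 c p then
    let l'1 := head (old p h') (left_copy h'0 c p) in
    let h := last (old p h') (right_copy h'0 c p) in
    match insub l'1, insub h with
    | Some d, Some h => @delete_dangling k (sew h'0 c p 2 l 1 (l - 1)) d h
    | _, _ => None
    end
  else None.

Definition Phi_right (k : nat) (x : triple k) : option (triple k) :=
  let c' := tcorner x in
  let h := thedge x in
  let h0 := nxt h in
  let p := rightmost h0 c' in
  let l := size p in
  if slittable h0 c' p then
    let r1 := head (old p h) (right_copy h0 c' p) in
    let h' := head (old p h) (rev_path (left_copy h0 c' p)) in
    match insub r1, insub h' with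
    | Some d, Some h' => @delete_dangling k (sew h0 c' p 1 (l - 1) 2 l) d h'
    | _, _ => None
    end
  else None.

Section Types.
Variables (r : nat) (a : 'I_r.+1 -> nat).

Definition tilde (i : 'I_r.+1) : nat :=
  if i == ord0 then a i + 1 else if i == ord_max then a i - 1 else a i.

Definition M_left (x : triple r.+1) : Prop :=
  [/\ is_map x a, in_face ord0 (tcorner x),
      in_face ord_max (thedge x) && half_edge (thedge x) &
      toward (thedge x) (tcorner x)].

Definition M_right (x : triple r.+1) : Prop :=
  [/\ is_map x tilde, in_face ord_max (tcorner x),
      in_face ord0 (thedge x) && half_edge (thedge x) &
      away (thedge x) (tcorner x)].

End Types.

(* Maps are considered up to orientation-preserving homeomorphism, so that the
   sets of triples are the predicates above up to isomorphism. *)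
Definition iso (k : nat) (x y : triple k) : Prop :=
  exists g : x -> y,
    [/\ bijective g,
        [/\ {morph g : z / rv z}, {morph g : z / nxt z} &
            forall z, lab (g z) = lab z],
        g (tcorner x) = tcorner y &
        g (thedge x) = thedge y].

Section Mappings.
Variables (k : nat) (P Q : triple k -> Prop).
Variables (F G : triple k -> option (triple k)).

(* F induces a mapping from P to Q, both up to isomorphism. *)
Definition well_defined : Prop :=
  (forall x, P x -> exists2 y, F x = Some y & Q y) /\
  (forall x x' y y', P x -> P x' -> iso x x' ->
     F x = Some y -> F x' = Some y' -> iso y y').

(* G \o F is the identity of P up to isomorphism. *)
Definition inverse_on : Prop :=
  forall x, P x ->
    exists y, exists2 x', F x = Some y /\ G y = Some x' & iso x' x.

End Mappings.

(* Main.v *)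
Require Import Defs.
From mathcomp Require Import all_boot.

Set Implicit Arguments.
Unset Strict Implicit.
Unset Printing Implicit Defensive.

(** Both constructions can be carried by the elements of the original map.  If
    p_1, ..., p_l is the slit path, then [Phi_left] pairs p_i with rev(p_{i-1})
    (indices modulo l) instead of rev(p_i), and moves h' = p_1 in the contours
    from its place to the corner c; this is a "slide".  [Phi_right] is the mirror
    image of the same operation, so that everything reduces to one slide along a
    leftmost geodesic p, and to proving that the reverse of the slid path is the
    rightmost geodesic of the new map from the end of h to c'.

    Slitting splits each vertex v_i of p into a left and a right side, and the
    slide glues the left side of v_{i+1} to the right side of v_i.  Let D be the
    distance to c in the original map, and let [height] be D, plus one on the
    left sides.  It is constant on the new vertices, it takes the value l - i on
    the i-th vertex of the slid path, and it varies by at most one along the new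
    edges: the only possible obstruction is an edge toward c leaving p from its
    left side, which does not exist as p is leftmost.  Hence the slid path is a
    geodesic, and the same argument shows that it is the rightmost one. *)

(** * Orbits of a function on a finite type *)

(** The indices modulo l come from a reuse of names. Sewing pairs p_i with rev(p_{i-1}) only for i
    >= 2; the half-edge p_1 disappears with the dangling edge, while the lip r_l survives and stays
    paired with rev(p_l). Giving r_l the free name p_1 closes the cycle, and the new map lives on
    the same elements, so that a composite of two slides can be compared with the identity element
    by element. The distances of the new map are never computed in general. The bound l - height(x)
    <= d(x, c') follows from the variation of [height] along edges, because c' has height l; the
    slid path attains it, and this suffices. Planarity is Euler's formula, hence a matter of
    counting: the sides of v_0, ..., v_l recombine into as many slid vertices, and no face is
    created or lost because h' and c lie in different faces, each of which keeps its marked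
    corner. *)

Lemma find_orbit (T : finType) (f : T -> T) (a : pred T) x0 x n :
    a (iter n f x) -> (forall j, j < n -> ~~ a (iter j f x)) ->
  nth x0 (orbit f x) (find a (orbit f x)) = iter n f x.
Proof.
move=> an na.
have n_lt : n < order f x.
  rewrite ltnNge; apply/negP=> le_n.
  have := fconnect_iter f n x => /[dup] /findex_max lt_i /iter_findex eq_i.
  by move: (na _ (leq_trans lt_i le_n)); rewrite eq_i an.
have nthE i : i < order f x -> nth x0 (orbit f x) i = iter i f x.
  by move=> lt_i; rewrite (set_nth_default x) ?size_orbit // nth_traject.
suff -> : find a (orbit f x) = n by rewrite nthE.
apply/eqP; rewrite eqn_leq; apply/andP; split.
  rewrite leqNgt; apply/negP=> /(before_find x0).
  by rewrite nthE // an.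
rewrite leqNgt; apply/negP=> lt_fn.
have lt_fo := ltn_trans lt_fn n_lt.
have := nth_find x0 (_ : has a (orbit f x)); rewrite nthE // => /(_ _) afind.
have /afind : has a (orbit f x) by rewrite has_find size_orbit.
by apply/negP; apply: na.
Qed.

Lemma orbit_morph (T U : finType) (f : T -> T) (g : U -> U) (u : T -> U) x :
  injective u -> (forall y, u (f y) = g (u y)) ->
  orbit g (u x) = map u (orbit f x).
Proof.
move=> u_inj ufg.
have iterE n : iter n g (u x) = u (iter n f x) by elim: n => //= n ->.
have trajE n y : traject g (u y) n = map u (traject f y n).
  by elim: n y => //= n IHn y; rewrite -ufg IHn.
suff ord_eq : order g (u x) = order f x by rewrite /orbit ord_eq trajE.
rewrite /order -(card_image u_inj); apply: eq_card => y.
apply/idP/imageP => [/iter_findex <- | [z]].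
  rewrite iterE; exists (iter (findex g (u x) y) f x) => //.
  exact: fconnect_iter.
by move=> /iter_findex <- ->; rewrite -iterE; apply: fconnect_iter.
Qed.

Lemma fconnect_morph (T U : finType) (f : T -> T) (g : U -> U) (u : T -> U) :
  injective u -> (forall y, u (f y) = g (u y)) ->
  forall x y, fconnect g (u x) (u y) = fconnect f x y.
Proof.
move=> u_inj ufg x y.
by rewrite !fconnect_orbit (orbit_morph _ u_inj ufg) (mem_map u_inj).
Qed.

(** Orbits are counted as the values of a complete invariant [V]; the vertices or faces of two maps
    are later compared by giving both the same set of values. *)
Lemma fcard_image (T U : finType) (f : T -> T) (V : T -> U) :
    injective f -> (forall x y, fconnect f x y = (V x == V y)) ->
  fcard f T = #|[set V x | x in T]|.
Proof.
move=> f_inj fV; have f_sym := fconnect_sym f_inj.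
rewrite /n_comp_mem; transitivity #|[set V x | x in froots f]|.
  rewrite card_in_imset; first by apply: eq_card => x; rewrite !inE andbT.
  move=> x y /eqP rx /eqP ry /eqP; rewrite -fV => /(rootP f_sym).
  by rewrite rx ry.
apply: eq_card => y; apply/imsetP/imsetP => [[x _ ->] | [x _ ->]].
  by exists x.
exists (froot f x); first exact: roots_root.
by apply/eqP; rewrite -fV connect_root.
Qed.

(** * Half-open arcs of an orbit *)

Section Arc.
Variables (T : finType) (f : T -> T) (f_inj : injective f).

(** The arc contains [s] but not [t]; when [s = t] it is empty, not the whole orbit. *)
Definition orbit_arc s t x := fconnect f s x && (findex f s x < findex f s t).

Lemma findexS s x :
  fconnect f s x -> f x != s -> findex f s (f x) = (findex f s x).+1.
Proof.
move=> sx fxs; have := findex_max sx; rewrite leq_eqVlt => /predU1P[eq_o|lt_o].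
  by case/eqP: fxs; rewrite -[RHS](iter_order f_inj) -eq_o /= iter_findex.
by rewrite -[in LHS](iter_findex sx) -iterS findex_iter.
Qed.

Variables (s t : T).
Hypothesis st : fconnect f s t.

Lemma arc_end : ~~ orbit_arc s t t.
Proof. by rewrite /orbit_arc ltnn andbF. Qed.

Lemma arc_start : s != t -> orbit_arc s t s.
Proof. by move=> neq; rewrite /orbit_arc connect0 findex0 lt0n findex_eq0. Qed.

Lemma arc_last x : f x = s -> ~~ orbit_arc s t x.
Proof.
move=> fx; apply/andP=> -[sx lt_x].
have lt_x1 := leq_ltn_trans lt_x (findex_max st).
have : findex f s (iter (findex f s x).+1 f s) = (findex f s x).+1.
  exact: findex_iter.
by rewrite /= iter_findex // fx findex0.
Qed.

Lemma arc_succ x : orbit_arc s t x -> f x != t -> orbit_arc s t (f x).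
Proof.
move=> x_in fxt; have fxs : f x != s.
  by apply/eqP=> /arc_last; rewrite x_in.
case/andP: x_in => sx lt_x; have sfx : fconnect f s (f x).
  exact: connect_trans sx (fconnect1 f x).
rewrite /orbit_arc sfx ltn_neqAle findexS // lt_x andbT.
rewrite -findexS //; apply: contra fxt => /eqP eq_i.
by rewrite -(iter_findex sfx) eq_i iter_findex.
Qed.

Lemma arc_pred x : orbit_arc s t (f x) -> f x != s -> orbit_arc s t x.
Proof.
move=> /andP[sfx lt_fx] fxs; have sx : fconnect f s x.
  by rewrite same_fconnect1_r.
by rewrite /orbit_arc sx /=; apply: ltn_trans lt_fx; rewrite findexS.
Qed.

Lemma arc_before_end x : f x = t -> t != s -> orbit_arc s t x.
Proof.
move=> fx ts; have sx : fconnect f s x by rewrite same_fconnect1_r // fx.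
by rewrite /orbit_arc sx -fx findexS ?ltnSn ?fx.
Qed.

End Arc.

(** * Distances and geodesics *)

Section Distance.
Variables (k : nat) (m : premap k).
Hypotheses (rvK : involutive (@rv k m)) (nxt_inj : injective (@nxt k m)).
Implicit Types (x y z t h : m) (p q : seq m).

Local Notation cwm := (@cw k m).

Lemma cw_inj : injective cwm.
Proof. by move=> x y /nxt_inj /(can_inj rvK). Qed.

Lemma cw_rv x : cw (rv x) = nxt x.
Proof. by rewrite /cw rvK. Qed.

Lemma finv_cw x : finv cwm x = rv (finv nxt x).
Proof. by apply: cw_inj; rewrite (f_finv cw_inj) cw_rv (f_finv nxt_inj). Qed.

Lemma half_edge_rv x : half_edge (rv x) = half_edge x.
Proof. by rewrite /half_edge rvK eq_sym. Qed.

Lemma same_vertex_refl x : same_vertex x x.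
Proof. exact: connect0. Qed.

Lemma same_vertex_sym x y : same_vertex x y = same_vertex y x.
Proof. exact: (fconnect_sym cw_inj). Qed.

Lemma same_vertex_trans y x z :
  same_vertex x y -> same_vertex y z -> same_vertex x z.
Proof. exact: connect_trans. Qed.

Lemma same_vertex_eql x y z :
  same_vertex x y -> same_vertex x z = same_vertex y z.
Proof. by move=> xy; apply: same_connect; first exact: (fconnect_sym cw_inj). Qed.

Lemma same_vertex_eqr x y z :
  same_vertex x y -> same_vertex z x = same_vertex z y.
Proof. by move=> xy; rewrite ![same_vertex z _]same_vertex_sym (same_vertex_eql _ xy). Qed.

Lemma same_vertex_cw x : same_vertex x (cw x).
Proof. exact: fconnect1. Qed.

Lemma same_vertex_nxt x : same_vertex (rv x) (nxt x).
Proof. by rewrite -cw_rv same_vertex_cw. Qed.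

Lemma walk_eql x y p z : same_vertex x y -> walk x p z = walk y p z.
Proof. by case: p => [|h p] xy /=; rewrite (same_vertex_eql _ xy). Qed.

Lemma walk_eqr x y p z : same_vertex x y -> walk z p x = walk z p y.
Proof.
by move=> xy; elim: p z => [|h p IHp] z /=; rewrite ?IHp ?(same_vertex_eqr _ xy).
Qed.

Lemma walk_cat x y z p q : walk x p y -> walk y q z -> walk x (p ++ q) z.
Proof.
elim: p x => [|h p IHp] x /=; first by move=> xy; rewrite (walk_eql _ _ xy).
by case/and3P=> -> -> /IHp.
Qed.

Lemma walk_rev x y p : walk x p y -> walk y (Defs.rev_path p) x.
Proof.
rewrite /Defs.rev_path; elim: p x => [|h p IHp] x /=.
  by rewrite same_vertex_sym.
case/and3P=> hh xh /IHp wp; rewrite rev_cons -cats1; apply: (walk_cat wp).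
by rewrite /= half_edge_rv hh rvK same_vertex_refl same_vertex_sym.
Qed.

Lemma dist_le x p y : walk x p y -> dist x y <= size p.
Proof.
move=> wp; rewrite /dist; case: (ltnP (size p) #|m|) => [lt_p | le_p].
  rewrite leqNgt; apply/negP=> /(before_find 0); rewrite nth_iota // add0n.
  by move/existsP; case; exists (in_tuple p).
by apply: leq_trans le_p; rewrite -[X in _ <= X](size_iota 0); apply: find_size.
Qed.

Lemma dist_eql x y t : same_vertex x y -> dist x t = dist y t.
Proof.
move=> xy; apply: eq_find => n; apply: eq_existsb => p; exact: walk_eql.
Qed.

Lemma dist_eqr x y t : same_vertex x y -> dist t x = dist t y.
Proof.
move=> xy; apply: eq_find => n; apply: eq_existsb => p; exact: walk_eqr.
Qed.

Hypothesis m_conn : connected m.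

Let step : rel m := [rel x y |
  [exists h, [&& half_edge h, same_vertex x h & same_vertex (rv h) y]]].

Lemma walk_path x y p : walk x p y -> same_vertex x y \/ connect step x y.
Proof.
elim: p x => [|h p IHp] x /=; first by left.
case/and3P=> hh xh /IHp hy; right.
case: hy => hy; first by apply/connect1/existsP; exists h; rewrite hh xh.
apply: connect_trans hy; apply/connect1/existsP; exists h.
by rewrite hh xh same_vertex_refl.
Qed.

Lemma path_walk x p : path step x p -> exists2 q, walk x q (last x p) & size q = size p.
Proof.
elim: p x => [|y p IHp] x /=; first by exists [::]; rewrite //= same_vertex_refl.
case/andP=> /existsP[h /and3P[hh xh hy]] /IHp[q wq sq].
by exists (h :: q); rewrite /= ?hh ?xh ?sq // (walk_eql _ _ hy).
Qed.

(* A shortest walk visits pairwise distinct elements, so that the bound [#|m|]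
   in [dist] is harmless. *)
Lemma dist_walk x y : exists2 p, walk x p y & size p = dist x y.
Proof.
have [q wq lt_q] : exists2 q, walk x q y & size q < #|m|.
  have [p /walk_path[xy|/connectP[p' + ->]]] := m_conn x y.
    by exists [::] => //; apply/card_gt0P; exists x.
  case/shortenP=> q /path_walk[r wr sr] uq _; exists r => //.
  by rewrite sr -[(size q).+1]/(size (x :: q)) -(card_uniqP uq) max_card.
have lt_d := leq_ltn_trans (dist_le wq) lt_q.
have := @nth_find _ 0 (fun n => [exists p : n.-tuple m, walk x p y]) (iota 0 #|m|).
rewrite has_find size_iota => /(_ lt_d); rewrite nth_iota // add0n.
by move/existsP=> [p wp]; exists p => //; rewrite size_tuple.
Qed.

Lemma dist_eq0 x y : (dist x y == 0) = same_vertex x y.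
Proof.
apply/eqP/idP => [d0 | xy]; last first.
  by apply/eqP; rewrite -leqn0; apply: (@dist_le x [::]).
by have [[|h p] // wp] := dist_walk x y; rewrite d0.
Qed.

Lemma dist_rv x t : half_edge x -> dist x t <= (dist (rv x) t).+1.
Proof.
move=> hx; have [p wp <-] := dist_walk (rv x) t.
by apply: (@dist_le _ (x :: p)); rewrite /= hx same_vertex_refl.
Qed.

Lemma dist_rv_le x t : half_edge x -> dist (rv x) t <= (dist x t).+1.
Proof. by move=> hx; rewrite -{2}(rvK x) dist_rv // half_edge_rv. Qed.

(** Prepending [h] to a shortest walk from its end gives a geodesic exactly when the distance drops
    by one, so being a first step is a local condition on [dist]. *)
Lemma first_stepE x t h :
  first_step x t h =
    [&& half_edge h, same_vertex x h & dist h t == (dist (rv h) t).+1].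
Proof.
apply/existsP/idP => [[[[|h' p] /= sp]] | /and3P[hh xh /eqP dh]].
- by case/andP.
- case/andP=> /andP[/= /and3P[hh xh wp] /eqP eq_d] /eqP[eq_h]; subst h'.
  rewrite hh xh /= eqn_leq dist_rv //= -(dist_eql t xh) -eq_d ltnS.
  exact: dist_le.
have [p wp sp] := dist_walk (rv h) t.
have sz : size (h :: p) == dist x t by rewrite (dist_eql t xh) dh /= sp.
by exists (Tuple sz); rewrite /geodesic /= hh xh wp eqxx andbT.
Qed.

Lemma ex_first_step x t : 0 < dist x t -> exists h, first_step x t h.
Proof.
have [[|h p] /= wp sp] := dist_walk x t; first by rewrite -sp.
case/and3P: wp => hh xh wp _; exists h; rewrite first_stepE hh xh /=.
by rewrite eqn_leq dist_rv //= -(dist_eql t xh) -sp ltnS dist_le.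
Qed.

Lemma geodesic_nth x p t x0 i : geodesic x p t -> i < size p ->
  [/\ half_edge (nth x0 p i), dist (nth x0 p i) t = size p - i &
      dist (rv (nth x0 p i)) t = size p - i.+1].
Proof.
elim: p x i => [|h p IHp] x i //= /andP[/= /and3P[hh xh wp] /eqP sp].
have dh : dist (rv h) t = size p.
  apply/eqP; rewrite eqn_leq dist_le //= -ltnS sp (dist_eql t xh).
  exact: dist_rv.
case: i => [_ | i lt_i] /=.
  by rewrite hh dh -(dist_eql t xh) -sp subSS !subn0.
by have [|-> -> ->] := IHp (rv h) i _ lt_i; rewrite ?subSS // /geodesic wp dh /=.
Qed.

(** The distance to [t] decreases by one at each vertex of a geodesic, so these vertices are
    distinct. *)
Lemma geodesic_self_avoiding x p t : geodesic x p t -> self_avoiding x p.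
Proof.
move=> gp; have /andP[wp /eqP sp] := gp; rewrite /self_avoiding.
apply: (@map_uniq _ _ (fun y => dist y t)); rewrite -map_comp.
have -> : map ((fun y => dist y t) \o froot cwm) (x :: map rv p) =
          [seq dist y t | y <- x :: map rv p].
  apply: eq_map => y /=; apply/esym/dist_eql; exact: connect_root.
suff -> : [seq dist y t | y <- x :: map rv p] =
          [seq size p - i | i <- iota 0 (size p).+1].
  rewrite map_inj_in_uniq ?iota_uniq // => i j.
  by rewrite !mem_iota /= !ltnS => le_i le_j /(congr1 (subn (size p))); rewrite !subKn.
apply: (@eq_from_nth _ 0) => [|i]; rewrite /= !size_map ?size_iota // ltnS => le_i.
case: i le_i => [|i] le_i; first by rewrite /= subn0.
rewrite [nth _ _ _]/= (nth_map x) ?size_map // (nth_map x) //.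
have [_ _ ->] := geodesic_nth x gp le_i.
by rewrite /= (nth_map 0) ?size_iota // nth_iota.
Qed.

Lemma geodesic_uniq x p t : geodesic x p t -> uniq p.
Proof.
move=> /geodesic_self_avoiding; rewrite /self_avoiding /= => /andP[_].
by move/map_uniq/map_uniq.
Qed.

Lemma geodesic_rv x p t y : geodesic x p t -> y \in p -> rv y \notin p.
Proof.
move=> gp; have lt_d z : z \in p -> dist (rv z) t < dist z t.
  case/(nthP x)=> i lt_i <-; have [_ -> ->] := geodesic_nth x gp lt_i.
  exact: ltn_sub2l.
move=> /lt_d lt_y; apply/negP=> /lt_d; rewrite rvK => /(ltn_trans lt_y).
by rewrite ltnn.
Qed.

Section TurningStep.
Variables (f : m -> m) (x y t : m).
Hypotheses (xy : same_vertex x y) (fE : fconnect f y =1 same_vertex y).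
Hypothesis dx : 0 < dist x t.

Let h := nth x (orbit f y) (find (first_step x t) (orbit f y)).

(** Both turning directions are treated at once: [f] is [cw] or its inverse, and [y] is the first
    element met around the vertex of [x]. *)
Lemma turning_first_step : first_step x t h.
Proof.
have [g sg] := ex_first_step dx; apply: nth_find; apply/hasP; exists g => //.
move: sg; rewrite first_stepE -fconnect_orbit fE => /and3P[_ + _].
by rewrite (same_vertex_eql _ xy).
Qed.

Lemma turning_min g : first_step x t g -> findex f y h <= findex f y g.
Proof.
move=> sg; have yg : fconnect f y g.
  by rewrite fE -(same_vertex_eql _ xy); move: sg; rewrite first_stepE => /and3P[].
have hs : has (first_step x t) (orbit f y).
  by apply/hasP; exists g; rewrite -?fconnect_orbit.
rewrite /findex /h index_uniq ?orbit_uniq -?has_find //.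
rewrite leqNgt; apply/negP=> /(before_find x).
by rewrite nth_index ?sg // -fconnect_orbit.
Qed.

End TurningStep.

Lemma first_step_dist x t h n :
  dist x t = n.+1 -> first_step x t h -> dist (rv h) t = n.
Proof.
by rewrite first_stepE => dx /and3P[_ xh]; rewrite -(dist_eql t xh) dx => /eqP[].
Qed.

Lemma leftmost_geodesic x t : geodesic x (leftmost x t) t.
Proof.
rewrite /geodesic /leftmost.
suff IH n : dist x t = n ->
    walk x (leftmost_rec n x t) t && (size (leftmost_rec n x t) == n) by exact: IH.
elim: n x => [|n IHn] x dx; first by rewrite /= andbT -dist_eq0 dx.
have sh := @turning_first_step cwm x x t (same_vertex_refl x) (fun _ => erefl).
rewrite /= eqSS; set h := nth _ _ _; have {}sh : first_step x t h.
  by apply: sh; rewrite dx.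
have dh := first_step_dist dx sh.
move: sh; rewrite first_stepE => /and3P[-> -> _] /=.
by rewrite (walk_eql _ _ (same_vertex_nxt h)) IHn // -(dist_eql t (same_vertex_nxt h)).
Qed.

(** What leftmost means at an inner vertex: among all first steps there, the path takes the one of
    least clockwise index from the corner following the half-edge by which it arrives. *)
Lemma leftmost_min x t (p := leftmost x t) x0 i g :
    i.+1 < size p -> first_step (nxt (nth x0 p i)) t g ->
  findex cwm (nxt (nth x0 p i)) (nth x0 p i.+1) <=
  findex cwm (nxt (nth x0 p i)) g.
Proof.
rewrite {}/p /leftmost.
move dx: (dist x t) => n; elim: n x dx i => [|n IHn] x dx i //=.
set h := nth x _ _; have sh : first_step x t h.
  by apply: turning_first_step; rewrite ?same_vertex_refl ?dx.
have dh : dist (nxt h) t = n.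
  by rewrite -(dist_eql t (same_vertex_nxt h)) (first_step_dist dx sh).
case: i => [|i] lt_i; last exact: IHn.
case: n dh {IHn dx sh} lt_i => [|n] //= dh _.
by apply: turning_min; rewrite ?same_vertex_refl ?dh.
Qed.

Lemma leftmost_head x t : half_edge x -> toward x t ->
  exists q, leftmost x t = x :: q.
Proof.
rewrite /toward /leftmost => hx lt_x; case dx: (dist x t) lt_x => [|n] //= lt_x.
exists (leftmost_rec n (nxt x) t); rewrite (@find_orbit _ _ _ x x 0) //=.
by rewrite first_stepE hx same_vertex_refl /= eqn_leq dist_rv // dx.
Qed.

Lemma rightmost_geodesic x t : geodesic x (rightmost x t) t.
Proof.
rewrite /geodesic /rightmost.
suff IH n : dist x t = n ->
    walk x (rightmost_rec n x t) t && (size (rightmost_rec n x t) == n) by exact: IH.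
elim: n x => [|n IHn] x dx; first by rewrite /= andbT -dist_eq0 dx.
rewrite /= eqSS; set h := nth _ _ _; have sh : first_step x t h.
  apply: turning_first_step; rewrite ?dx //; first exact: fconnect_finv.
  exact: (same_fconnect_finv cw_inj).
have dh := first_step_dist dx sh.
move: sh; rewrite first_stepE => /and3P[-> -> _] /=.
exact: IHn.
Qed.

(** Counterclockwise from the corner [nxt x], the first element met is [rv x], a first step since
    [x] is directed away. *)
Lemma rightmost_head x t : half_edge x -> away x t ->
  exists q, rightmost (nxt x) t = rv x :: q.
Proof.
rewrite /away /rightmost => hx.
rewrite (dist_eql t (same_vertex_nxt x)) => lt_x.
case dx: (dist (nxt x) t) lt_x => [|n] //= lt_x.
have fx : finv cwm (nxt x) = rv x by rewrite -cw_rv (finv_f cw_inj).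
have sx : first_step (nxt x) t (rv x).
  rewrite first_stepE half_edge_rv hx same_vertex_sym same_vertex_nxt rvK /=.
  by rewrite eqn_leq dist_rv_le //= (dist_eql t (same_vertex_nxt x)) dx.
exists (rightmost_rec n x t); rewrite fx.
by rewrite (@find_orbit _ _ _ _ (rv x) 0) //= rvK.
Qed.

End Distance.

(** * Sliding along a path *)

Section SlideDef.
Variables (k : nat) (m : premap k) (p : seq m) (c h : m).

Definition slide_rv (x : m) : m :=
  if x \in p then rv (prev p x)
  else if rv x \in p then next p (rv x) else rv x.

Definition slide_nxt (x : m) : m :=
  if x == h then c
  else if nxt x == h then nxt h
  else if nxt x == c then h else nxt x.

Definition slide_map : premap k := @Premap k m slide_rv slide_nxt lab.

(* The result of slitting m along p, sliding the lips by one step and sewing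
   them back, carried by the elements of m itself: the half-edge l_i of the new
   map is p_i, rev(r_i) is rev(p_i), and the new distinguished half-edge takes
   the name of the deleted one. *)
Definition slide : triple k := @Triple k slide_map (nxt h) h.

End SlideDef.

Section SlideContours.
Variables (k : nat) (m : premap k) (c h : m).
Hypotheses (nxt_inj : injective (@nxt k m)).
Hypotheses (nxt_h : nxt h != h) (c_h : c != h) (nxt_h_c : nxt h != c).

(** A slide of contours is undone by another one: [h] is put back in front of its former successor
    [nxt h], the corner distinguished by [slide]. *)
Lemma slide_nxtK (p : seq m) (x : m) :
  slide_nxt (m := slide_map p c h) (@nxt k m h) h x = nxt x.
Proof.
rewrite /slide_nxt /= /slide_nxt /= !eqxx.
case: (eqVneq x h) => [->|xh] //.
case: (eqVneq (nxt x) h) => [nx|nx]; first by rewrite (negPf nxt_h) eqxx.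
case: (eqVneq (nxt x) c) => [->|nxc]; first by rewrite eqxx.
by rewrite (negPf nx) (inj_eq nxt_inj) (negPf xh).
Qed.

Lemma slide_nxt_inj : injective (slide_nxt c h).
Proof.
have E x : slide_nxt c h x = if x == h then c else
  if nxt x == h then nxt h else if nxt x == c then h else nxt x by [].
move=> x y; rewrite !E.
case: (eqVneq x h) => [->|xh]; case: (eqVneq y h) => [->|yh] //.
- case: eqP => [_ e|_]; first by move: nxt_h_c; rewrite e eqxx.
  by case: eqP => [_ e|ne e]; [move: c_h; rewrite e eqxx | case: ne].
- case: eqP => [_ e|_]; first by move: nxt_h_c; rewrite e eqxx.
  by case: eqP => [_ e|ne e]; [move: c_h; rewrite e eqxx | case: ne].
case: (eqVneq (nxt x) h) => [nx|nx]; case: (eqVneq (nxt y) h) => [ny|ny].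
- by move=> _; apply: nxt_inj; rewrite nx ny.
- case: eqP => [_ e|_ /nxt_inj e]; first by move: nxt_h; rewrite e eqxx.
  by move: yh; rewrite e eqxx.
- case: eqP => [_ e|_ /nxt_inj e]; first by move: nxt_h; rewrite -e eqxx.
  by move: xh; rewrite e eqxx.
case: (eqVneq (nxt x) c) => [cx|cx]; case: (eqVneq (nxt y) c) => [cy|cy].
- by move=> _; apply: nxt_inj; rewrite cx cy.
- by move=> e; rewrite e eqxx in ny.
- by move=> e; rewrite e eqxx in nx.
exact: nxt_inj.
Qed.

Lemma slide_fconnectW x y : x != h -> y != h ->
  fconnect (slide_nxt c h) x y -> fconnect nxt x y.
Proof.
move=> xh yh.
(* The face of [x], with [h] counted in the face of [c], is stable under the slid contours. *)
pose F u := if u == h then fconnect nxt x c else fconnect nxt x u.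
have F_inv : invariant (slide_nxt c h) F =1 xpredT.
  move=> u; apply/(introT eqP); rewrite /F /slide_nxt.
  case: (eqVneq u h) => [_|uh]; first by rewrite (negPf c_h).
  case: (eqVneq (nxt u) h) => [nu|nu].
    by rewrite (negPf nxt_h) -nu -!same_fconnect1_r.
  case: (eqVneq (nxt u) c) => [<-|cu]; first by rewrite eqxx -same_fconnect1_r.
  by rewrite (negPf nu) -same_fconnect1_r.
move/(fconnect_invariant F_inv); rewrite /F (negPf xh) (negPf yh) connect0.
by move/esym.
Qed.

End SlideContours.

Section SlideFaces.
Variables (k : nat) (m : premap k) (c h : m).
Hypotheses (nxt_inj : injective (@nxt k m)).
Hypotheses (nxt_h : nxt h != h) (c_h : c != h) (nxt_h_c : nxt h != c).

Lemma slide_fconnect x y : x != h -> y != h ->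
  fconnect (slide_nxt c h) x y = fconnect nxt x y.
Proof.
move=> xh yh; apply/idP/idP; first exact: slide_fconnectW.
(* The converse is the same implication for the slide back, taken along the empty path. *)
rewrite -(eq_fconnect (slide_nxtK c nxt_inj nxt_h [::])).
have nh : @nxt k (slide_map [::] c h) h = c by rewrite /= /slide_nxt eqxx.
have inj' : injective (@nxt k (slide_map [::] c h)).
  exact: slide_nxt_inj nxt_inj nxt_h c_h nxt_h_c.
apply: (@slide_fconnectW k (slide_map [::] c h) (@nxt k m h) h inj') => //.
by rewrite nh.
Qed.

Lemma slide_fconnect_h y : y != h ->
  fconnect (slide_nxt c h) y h = fconnect nxt y c.
Proof.
move=> yh; rewrite (same_fconnect1_r (slide_nxt_inj nxt_inj nxt_h c_h nxt_h_c)).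
by rewrite {2}/slide_nxt eqxx slide_fconnect.
Qed.

End SlideFaces.

Section SlideInvolution.
Variables (k : nat) (m : premap k) (p : seq m) (c h : m).
Hypotheses (rvK : involutive (@rv k m)) (p_uniq : uniq p).
Hypotheses (p_rv : forall x, x \in p -> rv x \notin p).
Hypothesis p_half : forall x, x \in p -> half_edge x.

Lemma slide_rvK : involutive (slide_rv p).
Proof.
move=> x; rewrite {2}/slide_rv; case: ifP => [px|npx].
  have px' : prev p x \in p by rewrite mem_prev.
  by rewrite /slide_rv (negPf (p_rv px')) rvK px' next_prev.
case: ifP => [prx|nprx].
  by rewrite /slide_rv mem_next prx prev_next // rvK.
by rewrite /slide_rv nprx rvK npx.
Qed.

Lemma slide_half_edge (x : m) :
  half_edge (x : slide_map p c h) = half_edge x.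
Proof.
rewrite /half_edge /= /slide_rv; case: ifP => [px|npx].
  have := p_half px; rewrite /half_edge => ->; apply/eqP=> e.
  have px' : prev p x \in p by rewrite mem_prev.
  by have := p_rv px'; rewrite e px.
case: ifP => // prx; have := p_half prx; rewrite /half_edge rvK eq_sym => ->.
by apply/eqP=> e; move: npx; rewrite -e mem_next prx.
Qed.

End SlideInvolution.

Lemma walk_nth k (m : premap k) (x t : m) p i :
    walk x p t -> i < size p ->
  same_vertex (rv (nth t p i)) (nth t p i.+1).
Proof.
elim: p x i => [|h p IHp] x [|i] //= /and3P[_ _ wp] lt_i; last exact: IHp wp lt_i.
by case: p wp {IHp lt_i} => [|h' p] //= /and3P[].
Qed.

Lemma next_nth_rcons (T : eqType) (x d : T) q i : uniq (x :: q) -> i < (size q).+1 ->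
  next (x :: q) (nth d (x :: q) i) = nth d (rcons q x) i.
Proof.
move=> uq lt_i; rewrite next_nth mem_nth // index_uniq // nth_rcons.
move: lt_i; rewrite ltnS leq_eqVlt => /predU1P[->|lt_i].
  by rewrite ltnn eqxx nth_default.
by rewrite lt_i (set_nth_default d).
Qed.

(** * Sliding along a leftmost geodesic *)

Section LeftSlide.
Variables (k : nat) (m : premap k) (c h : m).
Hypotheses (rvK : involutive (@rv k m)) (nxt_inj : injective (@nxt k m)).
Hypotheses (m_conn : connected m) (h_half : half_edge h) (h_toward : toward h c).
Hypotheses (h_c : ~~ fconnect nxt h c) (nxt_h : nxt h != h).

Local Notation cwm := (@cw k m).
Local Notation p := (leftmost h c).
Local Notation l := (size (leftmost h c)).
(** With default value [c], [P l] is the target corner, so that [P i] stands for the vertex v_i for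
    all [i <= l]. *)
Local Notation P := (nth c (leftmost h c)).

Let cwI : injective cwm := cw_inj rvK nxt_inj.
Let svS := same_vertex_sym rvK nxt_inj.

Lemma lpath_geodesic : geodesic h p c.
Proof. exact: leftmost_geodesic. Qed.

Lemma lpath_gt0 : 0 < l.
Proof.
have /andP[_ /eqP ->] := lpath_geodesic.
by apply: leq_ltn_trans h_toward.
Qed.

Lemma lpath0 : P 0 = h.
Proof. by have [q ->] := leftmost_head rvK nxt_inj m_conn h_half h_toward. Qed.

Lemma lpath_uniq : uniq p.
Proof. exact: geodesic_uniq lpath_geodesic. Qed.

Lemma lpath_rv x : x \in p -> rv x \notin p.
Proof. exact: geodesic_rv lpath_geodesic. Qed.

Lemma lpath_half x : x \in p -> half_edge x.
Proof.
case/(nthP c)=> i lt_i <-.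
by have [] := geodesic_nth rvK nxt_inj m_conn c lpath_geodesic lt_i.
Qed.

Lemma lpath_in i : i < l -> P i \in p.
Proof. exact: mem_nth. Qed.

Lemma dist_lpath i : i <= l -> dist (P i) c = l - i.
Proof.
rewrite leq_eqVlt => /predU1P[->|lt_i].
  rewrite nth_default // subnn; apply/eqP.
  by rewrite (dist_eq0 rvK nxt_inj m_conn) same_vertex_refl.
by have [] := geodesic_nth rvK nxt_inj m_conn c lpath_geodesic lt_i.
Qed.

Lemma dist_rv_lpath i : i < l -> dist (rv (P i)) c = l - i.+1.
Proof.
by move=> lt_i; have [] := geodesic_nth rvK nxt_inj m_conn c lpath_geodesic lt_i.
Qed.

Lemma lpath_succ i : i < l -> same_vertex (rv (P i)) (P i.+1).
Proof.
by move=> lt_i; have /andP[wp _] := lpath_geodesic; apply: walk_nth wp lt_i.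
Qed.

Lemma dist_sv x y : same_vertex x y -> dist x c = dist y c.
Proof. exact: dist_eql. Qed.

Lemma dist_cw x : dist (cw x) c = dist x c.
Proof. by apply/esym/dist_sv; apply: fconnect1. Qed.

Lemma lpath_neq_rv i j : i < l -> j < l -> P i != rv (P j).
Proof.
move=> lt_i lt_j; apply/eqP=> e.
by have := lpath_rv (lpath_in lt_j); rewrite -e lpath_in.
Qed.

Lemma dist_h : dist h c = l.
Proof. by have /andP[_ /eqP <-] := lpath_geodesic. Qed.

Lemma subn_lpath_inj i j : i <= l -> j <= l -> l - i = l - j -> i = j.
Proof. by move=> le_i le_j /(congr1 (subn l)); rewrite !subKn. Qed.

(* The left side of the i-th vertex of the slit path consists of the elements
   met clockwise from [lstart i] until [lend i]; at the last vertex, it stops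
   at the corner c. *)
Definition lstart i := nxt (P i).
Definition lend i := nth c (map cwm p) i.+1.

Definition left_side x := [exists i : 'I_l, orbit_arc cwm (lstart i) (lend i) x].

Lemma lendE i : i.+1 < l -> lend i = cw (P i.+1).
Proof. by move=> lt_i; rewrite /lend (nth_map c). Qed.

Lemma lend_last i : i.+1 = l -> lend i = c.
Proof. by move=> eq_i; rewrite /lend nth_default ?size_map ?eq_i. Qed.

Lemma lstart_succ i : i < l -> same_vertex (lstart i) (P i.+1).
Proof.
move=> lt_i; rewrite /lstart -(same_vertex_eql rvK nxt_inj _ (same_vertex_nxt rvK _)).
exact: lpath_succ.
Qed.

Lemma lstart_lend i : i < l -> fconnect cwm (lstart i) (lend i).
Proof.
move=> lt_i; apply: connect_trans (lstart_succ lt_i) _.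
move: (lt_i); rewrite leq_eqVlt => /predU1P[eq_i|lt_i1].
  by rewrite lend_last // nth_default ?eq_i ?connect0.
by rewrite lendE // fconnect1.
Qed.

Lemma lstart_neq_lend i : i.+1 < l -> lend i != lstart i.
Proof.
move=> lt_i; rewrite lendE // /lstart -(cw_rv rvK) (inj_eq cwI).
by apply: lpath_neq_rv => //; apply: ltnW.
Qed.

Lemma arc_dist i x : i < l -> orbit_arc cwm (lstart i) (lend i) x -> dist x c = l - i.+1.
Proof.
move=> lt_i /andP[sx _]; rewrite -dist_lpath //; apply/esym/dist_sv.
by rewrite svS; apply: same_vertex_trans (lstart_succ lt_i); rewrite svS.
Qed.

(** The vertices of p have distinct distances to [c], so the distance of [x] selects the only arc
    that may contain it. The arcs concern v_1, ..., v_l only: at v_0 the left side would be [h]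
    alone, whose name passes to the new half-edge. *)
Lemma left_sideP i x : i < l -> dist x c = l - i.+1 ->
  left_side x = orbit_arc cwm (lstart i) (lend i) x.
Proof.
move=> lt_i dx; apply/existsP/idP => [[j aj] | ai]; last by exists (Ordinal lt_i).
have := arc_dist (ltn_ord j) aj; rewrite dx.
by move/(subn_lpath_inj lt_i (ltn_ord j)) => [->].
Qed.

Lemma left_side_dist x : left_side x -> exists2 i, i < l & dist x c = l - i.+1.
Proof.
by case/existsP=> j aj; exists j => //; apply: arc_dist.
Qed.

Lemma left_side_lt x : left_side x -> dist x c < l.
Proof.
by case/left_side_dist=> i lt_i ->; rewrite ltn_subrL lpath_gt0.
Qed.

Lemma left_side_lpath i : i.+1 < l -> left_side (P i.+1).
Proof.
move=> lt_i; have lt_i0 := ltnW lt_i; rewrite (@left_sideP i) ?dist_lpath //.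
by apply: arc_before_end; rewrite ?lstart_lend ?lstart_neq_lend ?lendE.
Qed.

Lemma left_side_rv i : i < l -> ~~ left_side (rv (P i)).
Proof.
move=> lt_i; rewrite (@left_sideP i) ?dist_rv_lpath //.
by apply: arc_last; rewrite ?lstart_lend // cw_rv.
Qed.

Lemma left_side_cw i : i < l -> ~~ left_side (cw (P i)).
Proof.
case: i => [|i] lt_i.
  by apply/negP=> /left_side_lt; rewrite dist_cw lpath0 dist_h ltnn.
rewrite (@left_sideP i) ?dist_cw ?dist_lpath //; try exact: ltnW.
by rewrite -lendE // arc_end.
Qed.

Lemma dist_c : dist c c = 0.
Proof. by apply/eqP; rewrite (dist_eq0 rvK nxt_inj m_conn) same_vertex_refl. Qed.

Lemma left_side_c : ~~ left_side c.
Proof.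
have lt_l : l.-1 < l by rewrite prednK // lpath_gt0.
rewrite (@left_sideP l.-1) // ?prednK ?lpath_gt0 ?subnn ?dist_c //.
by rewrite /orbit_arc lend_last ?ltnn ?andbF // prednK // lpath_gt0.
Qed.

Lemma left_side_nxt i : i < l -> nxt (P i) != c -> left_side (nxt (P i)).
Proof.
move=> lt_i neq_c; have svn := lstart_succ lt_i.
rewrite (@left_sideP i) ?(dist_sv svn) ?dist_lpath //.
apply: arc_start; move: (lt_i); rewrite leq_eqVlt => /predU1P[eq_i|lt_i1].
  by rewrite lend_last.
by rewrite eq_sym lstart_neq_lend.
Qed.

Lemma left_side_succ x : left_side x -> x \notin p -> cw x != c -> left_side (cw x).
Proof.
move=> lx; have [i lt_i dx] := left_side_dist lx => npx ncx.
rewrite (@left_sideP i) ?dist_cw //; apply: arc_succ; rewrite ?lstart_lend //.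
  by rewrite -left_sideP.
move: (lt_i); rewrite leq_eqVlt => /predU1P[eq_i|lt_i1]; first by rewrite lend_last.
by rewrite lendE // (inj_eq cwI); apply: contraNneq npx => ->; apply: lpath_in.
Qed.

Lemma left_side_pred x : left_side (cw x) -> rv x \notin p -> left_side x.
Proof.
move=> lx; have [i lt_i dx] := left_side_dist lx => npx.
rewrite (@left_sideP i) -1?dist_cw //; apply: arc_pred; rewrite // -?left_sideP //.
rewrite /lstart -(cw_rv rvK) (inj_eq cwI); apply: contraNneq npx => ->.
by rewrite rvK lpath_in.
Qed.

(** The exception is the empty arc, when [c] directly follows rev(p_l) around the last vertex. *)
Lemma left_side_before_c x : cw x = c -> x != rv (P l.-1) -> left_side x.
Proof.
move=> cx xr; have lt_l : l.-1 < l by rewrite prednK // lpath_gt0.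
have eq_l : l.-1.+1 = l by rewrite prednK // lpath_gt0.
rewrite (@left_sideP l.-1) ?eq_l ?subnn -1?dist_cw ?cx ?dist_c //.
apply: (arc_before_end cwI (lstart_lend lt_l)); rewrite lend_last //.
by rewrite /lstart -(cw_rv rvK) -{1}cx (inj_eq cwI).
Qed.

(** The leftmost choice enters here. The arc of v_{i+1} ends just after [P i.+1], so such a [y] is a
    first step met no later than [P i.+1], hence [P i.+1] itself. At the last vertex the distance is
    already 0. *)
Lemma left_side_first_step y :
  left_side y -> half_edge y -> dist (rv y) c < dist y c -> y \in p.
Proof.
move=> ly hy lt_y; have [i lt_i dy] := left_side_dist ly.
move: (ly); rewrite (left_sideP lt_i dy) => /andP[sy lt_f].
move: (lt_i); rewrite leq_eqVlt => /predU1P[eq_i|lt_i1].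
  by move: lt_y; rewrite dy eq_i subnn.
have sP : fconnect cwm (lstart i) (P i.+1) by apply: lstart_succ.
suff -> : y = P i.+1 by apply: lpath_in.
rewrite -(iter_findex sy) -(iter_findex sP); congr (iter _ _ _).
apply/eqP; rewrite eqn_leq; apply/andP; split.
  (* The arc excludes the successor of [P i.+1], whose index is one more because it does not wrap
     around to [lstart i]. *)
  have := lstart_neq_lend lt_i1; move: lt_f; rewrite lendE // => lt_f neq_s.
  by rewrite -ltnS -(findexS cwI sP).
apply: (leftmost_min rvK nxt_inj m_conn) => //.
rewrite (first_stepE rvK nxt_inj m_conn) hy eqn_leq dist_rv //= lt_y andbT.
exact: sy.
Qed.


(* Q is the path of the new map from the distinguished corner to the end of the
   distinguished half-edge: its i-th half-edge, for i < l, arises from sewing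
   l_{i+2} onto r_{i+1}. *)
Local Notation Q := (nth c (rcons (behead (leftmost h c)) h)).
Local Notation srv := (slide_rv (leftmost h c)).
Local Notation snxt := (slide_nxt c h).
Local Notation scw := (@cw k (slide_map (leftmost h c) c h)).

Lemma corner_neq_h : c != h.
Proof. by apply: contraNneq h_c => ->; apply: connect0. Qed.

Lemma nxt_neq_corner : nxt h != c.
Proof. by apply: contraNneq h_c => <-; apply: fconnect1. Qed.

Lemma lpath_cons : p = h :: behead p.
Proof. by have [q ->] := leftmost_head rvK nxt_inj m_conn h_half h_toward. Qed.

Lemma size_behead_lpath : size (behead p) = l.-1.
Proof. by rewrite size_behead. Qed.

Lemma slid_path_lt i : i.+1 < l -> Q i = P i.+1.
Proof.
move=> lt_i; rewrite nth_rcons size_behead_lpath -ltnS prednK ?lpath_gt0 //.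
by rewrite lt_i nth_behead.
Qed.

Lemma slid_path_last i : i.+1 = l -> Q i = h.
Proof.
by move=> eq_i; rewrite nth_rcons size_behead_lpath -eq_i ltnn eqxx.
Qed.

Lemma slid_path_end : Q l = c.
Proof. by rewrite nth_default // size_rcons size_behead_lpath prednK ?lpath_gt0. Qed.

Variant slid_path_spec i : m -> Prop :=
  | SlidPathLt of i.+1 < l : slid_path_spec i (P i.+1)
  | SlidPathLast of i.+1 = l : slid_path_spec i h.

Lemma slid_pathP i : i < l -> slid_path_spec i (Q i).
Proof.
rewrite leq_eqVlt => /predU1P[eq_i|lt_i].
  by rewrite slid_path_last //; constructor.
by rewrite slid_path_lt //; constructor.
Qed.

Lemma lpath_h : h \in p.
Proof. by rewrite lpath_cons mem_head. Qed.

Lemma slid_path_in i : i < l -> Q i \in p.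
Proof.
by case/slid_pathP=> [/lpath_in //|_]; apply: lpath_h.
Qed.

Lemma next_lpath i : i < l -> next p (P i) = Q i.
Proof.
move=> lt_i; have := @next_nth_rcons _ h c (behead p) i; rewrite -lpath_cons.
by apply; rewrite ?lpath_uniq // size_behead_lpath prednK ?lpath_gt0.
Qed.

Lemma slide_rv_rv i : i < l -> srv (rv (P i)) = Q i.
Proof.
move=> lt_i; rewrite /slide_rv (negPf (lpath_rv (lpath_in lt_i))) rvK.
by rewrite lpath_in // next_lpath.
Qed.

Lemma slide_rv_slid i : i < l -> srv (Q i) = rv (P i).
Proof.
by move=> lt_i; rewrite -(slide_rv_rv lt_i) (slide_rvK rvK lpath_uniq lpath_rv).
Qed.

Lemma slide_rv_other x : x \notin p -> rv x \notin p -> srv x = rv x.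
Proof. by rewrite /slide_rv => /negPf -> /negPf ->. Qed.

Lemma in_lpathP x : x \in p -> exists2 i, i < l & x = Q i.
Proof.
rewrite -{1}[x](next_prev lpath_uniq) mem_next => /(nthP c)[i lt_i] eq_x.
by exists i => //; rewrite -next_lpath // eq_x next_prev ?lpath_uniq.
Qed.

Lemma rv_in_lpathP x : rv x \in p -> exists2 i, i < l & x = rv (P i).
Proof. by case/(nthP c)=> i lt_i eq_x; exists i; rewrite // eq_x rvK. Qed.

Lemma scw_other (x : m) : x \notin p -> rv x \notin p ->
  scw x = if cw x == h then nxt h else if cw x == c then h else cw x.
Proof.
move=> npx nprx; rewrite /cw /= slide_rv_other // /slide_nxt.
by case: eqVneq => [e|//]; move: nprx; rewrite e lpath_h.
Qed.

(** A junction of two sides: clockwise in the new map, [Q i] closes the left side of v_{i+1} and is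
    followed by what followed [P i], the beginning of the right side of v_i; [h], moved elsewhere,
    is stepped over. *)
Lemma scw_slid i : i < l -> scw (Q i) = if cw (P i) == h then nxt h else cw (P i).
Proof.
move=> lt_i; rewrite /cw /= slide_rv_slid // /slide_nxt -/(cw (P i)).
have := lpath_rv (lpath_in lt_i); case: eqVneq => [->|_ _]; first by rewrite lpath_h.
case: ifP => // _; case: eqVneq => // e.
have := dist_cw (P i); rewrite e dist_c dist_lpath ?(ltnW lt_i) // => /esym/eqP.
by rewrite subn_eq0 leqNgt lt_i.
Qed.

Lemma scw_rv_last : scw (rv (P l.-1)) = c.
Proof.
have eq_l : l.-1.+1 = l by rewrite prednK // lpath_gt0.
by rewrite /cw /= slide_rv_rv ?slid_path_last // ?eq_l // /slide_nxt eqxx.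
Qed.

Lemma dist_nxt_lpath i : i < l -> dist (nxt (P i)) c = l - i.+1.
Proof. by move=> lt_i; rewrite -(cw_rv rvK) dist_cw dist_rv_lpath. Qed.

Lemma lpath_S_neq_h i : i.+1 < l -> P i.+1 != h.
Proof.
move=> lt_i; apply/eqP=> e; have : P i.+1 == P 0 by rewrite lpath0 e.
by rewrite nth_uniq ?lpath_uniq ?lpath_gt0.
Qed.

(** The other junction: rev(p_{i+1}) closes the right side of v_{i+1} and is followed by the
    beginning of the left side of v_{i+2}. If that side is empty, [h] stands there, in front of
    [c]. *)
Lemma scw_rv i : i.+1 < l ->
  scw (rv (P i)) = if nxt (P i.+1) == c then h else nxt (P i.+1).
Proof.
move=> lt_i; rewrite /cw /= slide_rv_rv 1?ltnW // slid_path_lt // /slide_nxt.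
rewrite (negPf (lpath_S_neq_h lt_i)); case: eqVneq => // e.
have := dist_nxt_lpath lt_i; rewrite e dist_h => /esym/eqP.
by rewrite eqn_leq [_ <= _ - _]leqNgt ltn_subrL lpath_gt0 andbF.
Qed.

(* In the new map, [height] is the distance to the end of the distinguished
   half-edge, at least along the slid path. *)
Definition height x := if x == h then 1 else dist x c + left_side x.

Lemma height_slid i : i <= l -> height (Q i) = l - i.
Proof.
rewrite leq_eqVlt /height => /predU1P[->|].
  by rewrite slid_path_end (negPf corner_neq_h) subnn dist_c (negPf left_side_c).
case/slid_pathP=> [lt_i|eq_i]; last by rewrite eqxx -eq_i subSnn.
rewrite (negPf (lpath_S_neq_h lt_i)) left_side_lpath // addn1 dist_lpath 1?ltnW //.
by rewrite subnS prednK // subn_gt0 ltnW.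
Qed.

Lemma rv_neq_h i : i < l -> rv (P i) != h.
Proof.
move=> lt_i; have := lpath_rv (lpath_in lt_i).
by apply: contraNneq => ->; apply: lpath_h.
Qed.

Lemma height_rv i : i < l -> height (rv (P i)) = l - i.+1.
Proof.
move=> lt_i; rewrite /height (negPf (rv_neq_h lt_i)) dist_rv_lpath //.
by rewrite (negPf (left_side_rv lt_i)) addn0.
Qed.

Lemma dist_neq_h x : dist x c < l -> x != h.
Proof. by apply: contraTneq => ->; rewrite dist_h ltnn. Qed.

Lemma height_nxt i : i < l -> nxt (P i) != c -> height (nxt (P i)) = l - i.
Proof.
move=> lt_i neq_c; rewrite /height left_side_nxt // dist_nxt_lpath //.
rewrite (negPf (dist_neq_h _)) ?dist_nxt_lpath ?ltn_subrL ?lpath_gt0 //.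
by rewrite addn1 subnS prednK // subn_gt0.
Qed.

Lemma height_nxt_h : height (nxt h) = l.
Proof.
by have := height_nxt lpath_gt0; rewrite lpath0 subn0; apply; apply: nxt_neq_corner.
Qed.

(** Away from the junctions, turning stays on one side of one old vertex. At a junction, the left
    side of a vertex meets the right side of the preceding vertex, which is one farther from [c]:
    the added one makes up for it. *)
Lemma height_scw (x : m) : height (scw x) = height x.
Proof.
case px: (x \in p).
  case/in_lpathP: px => i lt_i ->; rewrite scw_slid // height_slid ?(ltnW lt_i) //.
  have dcw : dist (cw (P i)) c = l - i by rewrite dist_cw dist_lpath // ltnW.
  case: eqVneq => [e|e]; first by rewrite height_nxt_h -dcw e dist_h.
  by rewrite /height (negPf e) dcw (negPf (left_side_cw lt_i)) addn0.
case prx: (rv x \in p).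
  have [i lt_i ->] := rv_in_lpathP prx; rewrite height_rv //.
  move: (lt_i); rewrite leq_eqVlt => /predU1P[eq_i|lt_i1].
    have -> : i = l.-1 by rewrite -eq_i.
    have := height_slid (leqnn l); rewrite slid_path_end scw_rv_last => ->.
    by rewrite prednK ?lpath_gt0.
  rewrite scw_rv //; case: eqVneq => [e|e]; last by rewrite height_nxt.
  have := dist_nxt_lpath lt_i1; rewrite e dist_c => /esym/eqP.
  rewrite /height eqxx subn_eq0 => le_l.
  have -> : l = i.+2 by apply/eqP; rewrite eqn_leq le_l lt_i1.
  by rewrite subSnn.
move/negbT: px => px; move/negbT: prx => prx; rewrite scw_other //.
have xh : x != h by apply: contraNneq px => ->; apply: lpath_h.
(* Turning used to meet [h] at v_0, which has no left side; it now goes on to [nxt h], on the left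
   side of v_1. *)
case: (eqVneq (cw x) h) => [e|e].
  have dx : dist x c = l by rewrite -dist_cw e dist_h.
  rewrite height_nxt_h /height (negPf xh) dx; case lx: (left_side x).
    by have := left_side_lt lx; rewrite dx ltnn.
  by rewrite addn0.
(* Here [x] closes the left side of v_l, and [h] is inserted after it at height 1. *)
case: (eqVneq (cw x) c) => [ec|ec].
  rewrite /height eqxx (negPf xh) -dist_cw ec dist_c left_side_before_c //.
  apply: contraNneq prx => ->; rewrite rvK lpath_in //.
  by rewrite prednK ?lpath_gt0.
rewrite /height (negPf e) (negPf xh) dist_cw; congr (_ + nat_of_bool _).
by apply/idP/idP => [/left_side_pred|/left_side_succ]; apply.
Qed.

Lemma height_srv x : half_edge x -> height (srv x) <= (height x).+1.
Proof.
move=> hx; case px: (x \in p).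
  case/in_lpathP: px => i lt_i ->.
  rewrite slide_rv_slid // height_slid ?(ltnW lt_i) // height_rv // subnS.
  by apply: leq_trans (leq_pred _) _.
case prx: (rv x \in p).
  have [i lt_i ->] := rv_in_lpathP prx.
  rewrite slide_rv_rv // height_rv // height_slid ?(ltnW lt_i) // subnS.
  by rewrite prednK ?subn_gt0.
move/negbT: px => px; move/negbT: prx => prx; rewrite slide_rv_other //.
have xh : x != h by apply: contraNneq px => ->; apply: lpath_h.
have rxh : rv x != h by apply: contraNneq prx => ->; apply: lpath_h.
rewrite /height (negPf xh) (negPf rxh).
have := dist_rv_le rvK nxt_inj m_conn c hx; rewrite leq_eqVlt ltnS.
case/predU1P=> [eq_d|le_d]; last first.
  apply: leq_trans (_ : dist x c + 1 <= _); last by rewrite addn1 ltnS leq_addr.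
  by apply: leq_add => //; case: left_side.
rewrite eq_d; case lx: (left_side (rv x)); last by rewrite addn0 ltnS leq_addr.
(* The excluded edge is [rv x], oriented toward [c]. *)
case/negP: prx; apply: left_side_first_step; rewrite ?half_edge_rv //.
by rewrite rvK eq_d.
Qed.

(** * Vertices of the slid map *)

Definition on_path x := [exists i : 'I_l.+1, same_vertex (P i) x].

Lemma on_path_lpath i : i <= l -> on_path (P i).
Proof.
by rewrite -ltnS => lt_i; apply/existsP; exists (Ordinal lt_i); apply: connect0.
Qed.

Lemma on_path_sv x y : same_vertex x y -> on_path x = on_path y.
Proof.
by move=> xy; apply: eq_existsb => i; apply: same_vertex_eqr xy.
Qed.

Lemma on_path_cw x : on_path (cw x) = on_path x.
Proof. by apply/esym/on_path_sv; apply: fconnect1. Qed.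

Lemma on_path_dist x : on_path x -> dist x c <= l /\ same_vertex (P (l - dist x c)) x.
Proof.
case/existsP=> -[i lt_i] /= ix.
by rewrite -(dist_sv ix) dist_lpath // leq_subr subKn.
Qed.

Lemma on_path_rv i : i < l -> on_path (rv (P i)).
Proof. by move=> lt_i; rewrite (on_path_sv (lpath_succ lt_i)) on_path_lpath. Qed.

Lemma on_path_nxt i : i < l -> on_path (nxt (P i)).
Proof. by move=> lt_i; rewrite -(cw_rv rvK) on_path_cw on_path_rv. Qed.

Lemma on_path_in x : x \in p -> on_path x.
Proof. by case/(nthP c)=> i lt_i <-; rewrite on_path_lpath // ltnW. Qed.

Lemma on_path_h : on_path h.
Proof. exact/on_path_in/lpath_h. Qed.

Lemma on_path_nxt_h : on_path (nxt h).
Proof. by have := on_path_nxt lpath_gt0; rewrite lpath0. Qed.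

Lemma on_path_c : on_path c.
Proof. by have := on_path_lpath (leqnn l); rewrite nth_default. Qed.

Lemma on_path_rv_in x : rv x \in p -> on_path x.
Proof. by case/rv_in_lpathP=> i lt_i ->; apply: on_path_rv. Qed.

Lemma scw_off_path (x : m) : ~~ on_path x -> scw x = cw x.
Proof.
move=> nx; rewrite scw_other; first last.
- by apply: contra nx => /on_path_rv_in.
- by apply: contra nx => /on_path_in.
case: eqVneq => [e|_]; first by move: nx; rewrite -on_path_cw e on_path_h.
by case: eqVneq => [e|//]; move: nx; rewrite -on_path_cw e on_path_c.
Qed.

Lemma on_path_scw (x : m) : on_path (scw x) = on_path x.
Proof.
case px: (x \in p).
  rewrite (on_path_in px); case/in_lpathP: px => i lt_i ->; rewrite scw_slid //.
  by case: ifP => _; rewrite ?on_path_nxt_h // on_path_cw on_path_lpath // ltnW.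
case prx: (rv x \in p).
  rewrite (on_path_rv_in prx); have [i lt_i ->] := rv_in_lpathP prx.
  move: (lt_i); rewrite leq_eqVlt => /predU1P[eq_i|lt_i1].
    have -> : i = l.-1 by rewrite -eq_i.
    by rewrite scw_rv_last on_path_c.
  by rewrite scw_rv //; case: ifP => _; rewrite ?on_path_h ?on_path_nxt.
rewrite scw_other ?px ?prx // -(on_path_cw x).
case: eqVneq => [->|_]; first by rewrite on_path_h on_path_nxt_h.
by case: eqVneq => [->|//]; rewrite on_path_h on_path_c.
Qed.

Lemma height_le x : on_path x -> height x <= l.
Proof.
case/on_path_dist=> le_x _; rewrite /height; case: ifP => _; first exact: lpath_gt0.
case lx: (left_side x); last by rewrite addn0.
by rewrite addn1; apply: left_side_lt.
Qed.

Lemma scw_inj : injective scw.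
Proof.
apply: cw_inj; first exact: slide_rvK rvK lpath_uniq lpath_rv.
exact: slide_nxt_inj nxt_inj nxt_h corner_neq_h nxt_neq_corner.
Qed.

(** Clockwise, one stays on a left side until a half-edge of p, or until [c], in front of which [h]
    now stands; either way some [Q i] is met, and its index is read off the constant [height]. The
    induction is on the number of old turns before rev(p_{i+1}), which lies beyond the left side. *)
Lemma left_side_slid x : left_side x -> fconnect scw x (Q (l - height x)).
Proof.
move=> lx; have [i lt_i dx] := left_side_dist lx.
have xr : fconnect cwm x (rv (P i)).
  have /andP[sx _] : orbit_arc cwm (lstart i) (lend i) x by rewrite -left_sideP.
  rewrite fconnect_sym //; apply: connect_trans sx.
  exact: same_vertex_nxt.
move: (iter_findex xr); move: (findex _ _ _) => n {xr dx}.
elim: n x lx => [|n IHn] x lx.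
  by move=> /= e; move: lx; rewrite e (negPf (left_side_rv lt_i)).
rewrite iterSr => /IHn{}IHn.
case px: (x \in p).
  case/in_lpathP: px => j lt_j ->.
  by rewrite height_slid ?(ltnW lt_j) // subKn ?(ltnW lt_j) // connect0.
have prx : rv x \notin p.
  apply/negP=> /rv_in_lpathP[j lt_j e].
  by move: lx; rewrite e (negPf (left_side_rv lt_j)).
apply: connect_trans (fconnect1 scw x) _; rewrite -(height_scw x) scw_other ?px //.
have ncx : cw x != h by apply: dist_neq_h; rewrite dist_cw left_side_lt.
rewrite (negPf ncx); case: eqVneq => [e|e]; last first.
  by apply: IHn; apply: left_side_succ; rewrite ?px.
by rewrite /height eqxx subn1 slid_path_last ?connect0 // prednK ?lpath_gt0.
Qed.

Lemma slid_connect_via x (y := scw x) : fconnect scw y (Q (l - height y)) ->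
  fconnect scw x (Q (l - height x)).
Proof. by rewrite height_scw; apply: connect_trans (fconnect1 scw x). Qed.

Lemma rv_slid i : i < l -> fconnect scw (rv (P i)) (Q (l - height (rv (P i)))).
Proof.
move=> lt_i; apply: slid_connect_via.
move: (lt_i); rewrite leq_eqVlt => /predU1P[eq_i|lt_i1].
  have -> : i = l.-1 by rewrite -eq_i.
  rewrite scw_rv_last; have := height_slid (leqnn l).
  by rewrite slid_path_end => ->; rewrite subKn // slid_path_end connect0.
rewrite scw_rv //; case: eqVneq => [_|e]; last exact/left_side_slid/left_side_nxt.
by rewrite /height eqxx subn1 slid_path_last ?connect0 // prednK ?lpath_gt0.
Qed.

(** All elements of the path at one height form a single new vertex: a right side leads clockwise to
    the left side glued after it, and from there to [Q i]; at the last vertex it leads to [c]. *)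
Lemma on_path_slid x : on_path x -> fconnect scw x (Q (l - height x)).
Proof.
move=> ox; case lx: (left_side x); first exact: left_side_slid.
case: (eqVneq x h) => [->|xh].
  by rewrite /height eqxx subn1 slid_path_last ?connect0 // prednK ?lpath_gt0.
have [le_x svx] := on_path_dist ox.
have [i eq_i] : exists i, i = l - dist x c by eexists.
rewrite -eq_i in svx; have le_i : i <= l by rewrite eq_i leq_subr.
have {eq_i} dx : dist x c = l - i by rewrite eq_i subKn.
have not_p z : z != h -> left_side z = false -> z \notin p.
  move=> zh lz; apply/negP=> /(nthP c)[[|j] lt_j e].
    by move: zh; rewrite -e lpath0 eqxx.
  by move: lz; rewrite -e left_side_lpath.
(* The turn around v_i is followed up to [e]: rev(p_i), which closes the right side, or [h] at
   v_0. *)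
pose e := if i is j.+1 then rv (P j) else h.
have xe : fconnect cwm x e.
  rewrite /e; case: i le_i svx {dx e} => [|j] le_j; rewrite svS // => xP.
    by rewrite -lpath0.
  by apply: connect_trans xP _; rewrite (fconnect_sym cwI); apply: lpath_succ.
move: (iter_findex xe); move: (findex _ _ _) => n {xe svx ox le_x}.
elim: n x xh lx dx => [|n IHn] x xh lx dx.
  move=> /= ->; rewrite /e; case: {e dx} i le_i => [|j] le_j; last exact: rv_slid.
  by rewrite /height eqxx subn1 slid_path_last ?connect0 // prednK ?lpath_gt0.
rewrite iterSr => iter_e.
case prx: (rv x \in p); first by have [j lt_j ->] := rv_in_lpathP prx; apply: rv_slid.
have px := not_p _ xh lx.
apply: slid_connect_via; rewrite scw_other ?prx //; case: eqVneq => [_|ch].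
  have := left_side_nxt lpath_gt0; rewrite lpath0 => /(_ nxt_neq_corner).
  exact: left_side_slid.
case: eqVneq => [ec|nc].
  by rewrite /height eqxx subn1 slid_path_last ?connect0 // prednK ?lpath_gt0.
apply: IHn => //; last by rewrite dist_cw.
by apply/negbTE; apply: contraFN lx => /left_side_pred; apply; rewrite prx.
Qed.

(** Names the new vertices by old ones: the slid vertex at height l - i takes the name of v_i, and
    the vertices off the path keep theirs. This is a bijection between vertices, hence the equality
    of the two counts. *)
Definition slid_vertex x : m :=
  froot cwm (if on_path x then P (l - height x) else x).

Lemma slid_vertexE (x y : m) : fconnect scw x y = (slid_vertex x == slid_vertex y).
Proof.
apply/idP/eqP => [xy | ].
  have V_inv : invariant scw slid_vertex =1 xpredT.
    move=> z; apply/(introT eqP); rewrite /slid_vertex on_path_scw.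
    case oz: (on_path z); first by rewrite height_scw.
    rewrite scw_off_path ?oz //; apply/esym/(rootP (fconnect_sym cwI)).
    exact: fconnect1.
  exact: (fconnect_invariant V_inv xy).
rewrite /slid_vertex => /(rootP (fconnect_sym cwI)).
case ox: (on_path x); case oy: (on_path y) => xy.
- have eq_h : height x = height y.
    have := dist_sv xy; rewrite !dist_lpath ?leq_subr // !subKn ?height_le //.
  apply: connect_trans (on_path_slid ox) _; rewrite eq_h (fconnect_sym scw_inj).
  exact: on_path_slid.
- by move: oy; rewrite -(on_path_sv xy) on_path_lpath // leq_subr.
- by move: ox; rewrite (on_path_sv xy) on_path_lpath // leq_subr.
have <- := iter_findex xy; elim: (findex _ _ _) => [|n IHn] /=; first exact: connect0.
apply: connect_trans IHn _; rewrite -scw_off_path; first exact: fconnect1.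
rewrite -(@on_path_sv x) ?ox //; exact: fconnect_iter.
Qed.

Lemma fcard_scw : fcard scw m = fcard cwm m.
Proof.
rewrite (fcard_image scw_inj slid_vertexE) (@fcard_image _ _ _ (froot cwm) cwI).
  apply: eq_card => y; apply/imsetP/imsetP => [[x _ ->] | [x _ ->]].
    by exists (if on_path x then P (l - height x) else x).
  case ox: (on_path x); last by exists x; rewrite // /slid_vertex ox.
  have [le_x svx] := on_path_dist ox; exists (Q (l - dist x c)) => //.
  apply/esym/eqP; rewrite /slid_vertex height_slid ?leq_subr // subKn ?leq_subr //.
  have -> : on_path (Q (l - dist x c)).
    have := leq_subr (dist x c) l; rewrite leq_eqVlt => /predU1P[->|lt_x].
      by rewrite slid_path_end on_path_c.
    exact/on_path_in/slid_path_in.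
  by apply/eqP/(rootP (fconnect_sym cwI)).
by move=> x y; rewrite (root_connect (fconnect_sym cwI)).
Qed.

(** * Connectedness of the slid map and its geodesics to the distinguished corner *)

Local Notation mt := (slide_map (leftmost h c) c h).

Lemma slid_rvK : involutive (@rv k mt).
Proof. exact: slide_rvK rvK lpath_uniq lpath_rv. Qed.

Lemma slid_nxt_inj : injective (@nxt k mt).
Proof. exact: slide_nxt_inj nxt_inj nxt_h corner_neq_h nxt_neq_corner. Qed.

Lemma slid_half_edge (x : m) : @half_edge k mt x = half_edge x.
Proof. exact: slide_half_edge rvK lpath_rv lpath_half x. Qed.

Lemma height_same_vertex (x y : m) : @same_vertex k mt x y -> height x = height y.
Proof.
apply: fconnect_invariant => z; apply/(introT eqP); exact: height_scw.
Qed.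

Lemma height_walk (x y : m) (q : seq m) :
  @walk k mt x q y -> height y <= height x + size q.
Proof.
elim: q x => [|g q IHq] x /=; first by move/height_same_vertex->; rewrite addn0.
case/and3P; rewrite slid_half_edge => hg /height_same_vertex-> /IHq le_y.
apply: leq_trans le_y _; rewrite addnS -addSn leq_add2r; exact: height_srv.
Qed.

Lemma on_path_same_vertex x i : on_path x -> height x = l - i -> i <= l ->
  @same_vertex k mt x (Q i).
Proof.
by move=> /on_path_slid + hx le_i; rewrite hx subKn.
Qed.

Lemma rv_same_vertex i : i < l -> @same_vertex k mt (rv (P i)) (Q i.+1).
Proof. by move=> lt_i; apply: on_path_same_vertex; rewrite ?on_path_rv ?height_rv. Qed.

Lemma nxt_h_same_vertex : @same_vertex k mt (nxt h) (Q 0).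
Proof.
by apply: on_path_same_vertex; rewrite ?on_path_nxt_h ?height_nxt_h ?subn0.
Qed.

(** This is the slid path read backwards, through rev(p_i), ..., rev(p_1). *)
Lemma slid_walk i : i <= l ->
  exists2 q : seq m, @walk k mt (Q i) q (nxt h) & size q = i.
Proof.
elim: i => [|i IHi] lt_i.
  exists [::] => //=; rewrite (same_vertex_sym slid_rvK slid_nxt_inj).
  exact: nxt_h_same_vertex.
have [q wq sq] := IHi (ltnW lt_i); exists (rv (P i) :: q); rewrite /= ?sq //.
rewrite slid_half_edge half_edge_rv ?lpath_half ?lpath_in //.
rewrite (same_vertex_sym slid_rvK slid_nxt_inj) rv_same_vertex //=.
by rewrite slide_rv_rv.
Qed.

Let conn (x y : m) := exists q : seq m, @walk k mt x q y.

Lemma conn_trans y x z : conn x y -> conn y z -> conn x z.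
Proof.
move=> [q wq] [q' wq']; exists (q ++ q').
exact: (walk_cat slid_rvK slid_nxt_inj wq wq').
Qed.

Lemma conn_sym x y : conn x y -> conn y x.
Proof.
move=> [q wq]; exists (@Defs.rev_path k mt q).
exact: (walk_rev slid_rvK slid_nxt_inj wq).
Qed.

Lemma conn_on_path x y : on_path x -> on_path y -> conn x y.
Proof.
have to_nxt z : on_path z -> conn z (nxt h).
  move=> oz; have [q wq _] := slid_walk (leq_subr (height z) l).
  by exists q; rewrite (walk_eql slid_rvK slid_nxt_inj _ _ (on_path_slid oz)).
by move=> /to_nxt xn /to_nxt yn; apply: conn_trans xn (conn_sym yn).
Qed.

(** Both pieces of a split vertex lie on the slid path, which is connected; elsewhere turning is
    unchanged. *)
Lemma conn_cw (x : m) : conn x (cw x).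
Proof.
case ox: (on_path x); first by apply: conn_on_path; rewrite ?on_path_cw.
exists [::]; rewrite -(@scw_off_path x) ?ox //; exact: fconnect1.
Qed.

Lemma conn_same_vertex (x y : m) : same_vertex x y -> conn x y.
Proof.
move=> /iter_findex <-; elim: (findex _ _ _) => [|n IHn].
  by exists [::]; apply: connect0.
exact: conn_trans IHn (conn_cw _).
Qed.

Lemma conn_rv (x : m) : half_edge x -> conn x (rv x).
Proof.
move=> hx; case px: (x \in p).
  case/(nthP c): px => i lt_i <-.
  by apply: conn_on_path; rewrite ?on_path_rv ?on_path_lpath // ltnW.
case prx: (rv x \in p).
  by apply: conn_on_path; [apply: on_path_rv_in | apply: on_path_in].
exists [:: (x : mt)]; rewrite /= slid_half_edge hx slide_rv_other ?px ?prx //=.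
by rewrite !same_vertex_refl.
Qed.

Lemma slid_connected : connected mt.
Proof.
move=> x y; have [q] := m_conn x y; elim: q x => [|g q IHq] x /=.
  exact: conn_same_vertex.
case/and3P=> hg /conn_same_vertex xg /IHq gy.
exact: conn_trans xg (conn_trans (conn_rv hg) gy).
Qed.

(** [height] grows by at most one per edge, and it is l at the distinguished corner. *)
Lemma height_dist (x : m) : l <= height x + @dist k mt x (nxt h).
Proof.
have [q wq <-] := dist_walk slid_rvK slid_nxt_inj slid_connected x (nxt h).
by rewrite -height_nxt_h; apply: height_walk.
Qed.

Lemma dist_slid i : i <= l -> @dist k mt (Q i) (nxt h) = i.
Proof.
move=> le_i; apply/eqP; rewrite eqn_leq; apply/andP; split.
  by have [q wq {2}<-] := slid_walk le_i; apply: dist_le.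
have := height_dist (Q i); rewrite height_slid // -{1}(subnK le_i).
by rewrite leq_add2l.
Qed.

Lemma dist_slid_sv (x : m) i : i <= l -> @same_vertex k mt x (Q i) ->
  @dist k mt x (nxt h) = i.
Proof.
by move=> le_i xQ; rewrite (dist_eql slid_rvK slid_nxt_inj _ xQ) dist_slid.
Qed.

Lemma slid_away : @away k mt h (nxt h).
Proof.
have eq_l : l.-1.+1 = l by rewrite prednK // lpath_gt0.
have lt_l : l.-1 < l by rewrite eq_l.
have := slide_rv_slid lt_l; have := dist_slid (ltnW lt_l).
rewrite (slid_path_last eq_l) /away /= => -> ->.
by rewrite (dist_slid_sv _ (rv_same_vertex lt_l)) ?eq_l.
Qed.

(** Counterclockwise from the slid path, one goes back along a left side until the reverse of a
    half-edge of p. The bound on [height] leaves out the vertex of the distinguished corner, where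
    the left side of v_1 is preceded by the right side of v_0. *)
Lemma scw_back (u : m) : let v : m := scw u in
    height v < l -> [|| v == h, v == c | left_side v] ->
  rv u \in p \/ left_side u && (u \notin p).
Proof.
move=> v; rewrite {}/v => lt_h vP; case prx: (rv u \in p); [by left | right].
have lt_l : l.-1 < l by rewrite prednK // lpath_gt0.
case px: (u \in p).
  case/in_lpathP: px lt_h vP => i lt_i ->; rewrite scw_slid //.
  case: eqVneq => [_|nh _]; first by rewrite height_nxt_h ltnn.
  rewrite (negPf nh) (negPf (left_side_cw lt_i)) orbF /= => /eqP e.
  have := dist_cw (P i); rewrite e dist_c dist_lpath ?(ltnW lt_i) // => /esym/eqP.
  by rewrite subn_eq0 leqNgt lt_i.
move: lt_h vP; rewrite scw_other ?px ?prx // andbT.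
case: eqVneq => [_|nh]; first by rewrite height_nxt_h ltnn.
case: eqVneq => [e _ _|nc _]; last first.
  by rewrite (negPf nh) (negPf nc) /= => /left_side_pred; apply; rewrite prx.
apply: left_side_before_c => //; apply: contraFneq prx => ->.
by rewrite rvK lpath_in.
Qed.

(** If [u] were a first step, [height_dist] would make [rv u] higher than [u]. As distances to [c]
    vary by at most one, [rv u] would lie on a left side and go toward [c], which the leftmost
    choice excludes. *)
Lemma left_side_not_first_step (x u : m) n : left_side u -> u \notin p -> n < l ->
  @same_vertex k mt x (Q n.+1) -> ~~ @first_step k mt x (nxt h) u.
Proof.
move=> lu pu lt_n xQ; rewrite (first_stepE slid_rvK slid_nxt_inj slid_connected).
have pru : rv u \notin p.
  apply/negP=> /rv_in_lpathP[j lt_j e].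
  by move: lu; rewrite e (negPf (left_side_rv lt_j)).
apply/and3P=> -[]; rewrite slid_half_edge /= slide_rv_other // => hu xu.
rewrite -(dist_eql slid_rvK slid_nxt_inj _ xu) (dist_slid_sv lt_n xQ) eqSS => /eqP du.
have := height_dist (rv u); rewrite -du.
have hE : height u = l - n.+1.
  by rewrite -(height_same_vertex xu) (height_same_vertex xQ) height_slid.
have uh : u != h by apply: contraNneq pu => ->; apply: lpath_h.
have ruh : rv u != h by apply: contraNneq pru => ->; apply: lpath_h.
move: hE; rewrite /height (negPf uh) (negPf ruh) lu addn1 => hE.
have {hE} eq_l : (dist u c).+2 + n = l.
  by rewrite hE subnS prednK ?subn_gt0 // subnK // ltnW.
have le_d := dist_rv_le rvK nxt_inj m_conn c hu.
rewrite -{1}eq_l leq_add2r; case lru: (left_side (rv u)).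
  rewrite addn1 ltnS => lt_d; case/negP: pru; apply: left_side_first_step => //.
    by rewrite half_edge_rv.
  by rewrite rvK.
by rewrite addn0 ltnNge le_d.
Qed.

(** Counterclockwise from the slid vertex of index n + 1, only elements of a left side are met
    before rev(p_{n+1}). None of them is a first step, so the rightmost geodesic takes rev(p_{n+1}),
    whose new end is the slid vertex of index n. *)
Lemma rightmost_rec_slid n : n <= l ->
  @rightmost_rec k mt n (Q n) (nxt h) = rev (map rv (take n p)).
Proof.
elim: n => [|n IHn] lt_n; first by rewrite take0.
rewrite (take_nth c) // map_rcons rev_rcons /=.
set g := nth _ _ _; suff eg : g = rv (P n).
  by rewrite eg slide_rv_rv // IHn // ltnW.
have sfE := same_fconnect_finv scw_inj.
pose y : m := finv scw (Q n.+1); pose f : m -> m := finv scw.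
have yQ : @same_vertex k mt y (Q n.+1).
  by rewrite (same_vertex_sym slid_rvK slid_nxt_inj); apply: fconnect_finv.
have yg : fconnect f y (rv (P n)).
  rewrite sfE; apply: connect_trans yQ _.
  by rewrite (fconnect_sym scw_inj); apply: rv_same_vertex.
rewrite /g -/y -/f (@find_orbit _ f _ _ y (findex f y (rv (P n)))).
- exact: iter_findex.
- rewrite iter_findex // (first_stepE slid_rvK slid_nxt_inj slid_connected).
  rewrite slid_half_edge half_edge_rv ?lpath_half ?lpath_in //=.
  rewrite (same_vertex_sym slid_rvK slid_nxt_inj) rv_same_vertex //=.
  rewrite (dist_slid_sv _ (rv_same_vertex lt_n)) // slide_rv_rv //.
  by rewrite dist_slid // ltnW.
suff before j : j < findex f y (rv (P n)) ->
    left_side (iter j f y) && (iter j f y \notin p).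
  move=> j /before/andP[lj pj]; apply: left_side_not_first_step lj pj lt_n _.
  exact: same_vertex_refl.
(* Heights tell the reverses of the path apart: [rv (P n)] is the only one at this vertex. *)
have iter_rv i : i < findex f y (rv (P n)) -> @rv k m (iter i f y) \notin p.
  move=> lt_i; apply/negP=> /rv_in_lpathP[i' lt_i' e].
  have yi : fconnect scw y (iter i f y) by rewrite -sfE; apply: fconnect_iter.
  have := height_same_vertex yi; rewrite (height_same_vertex yQ) height_slid //.
  rewrite e height_rv // => /(subn_lpath_inj lt_n lt_i') [eq_n].
  have := findex_iter (ltn_trans lt_i (findex_max yg)).
  by rewrite e -eq_n => eq_i; move: lt_i; rewrite eq_i ltnn.
have fK (u : m) : scw (f u) = u by apply: (f_finv scw_inj).
elim: j => [|j IHj] lt_j.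
  have := iter_rv 0 lt_j; have := @scw_back y; rewrite [scw y](fK (Q n.+1)).
  move=> back nrv; case: back => //; last by rewrite (negPf nrv).
    by rewrite height_slid // ltn_subrL lpath_gt0.
  (* The starting element [Q n.+1] is [c] at the end of the path, [h] just before it, and an element
     of a left side otherwise. *)
  move: (lt_n); rewrite leq_eqVlt => /predU1P[->|lt_n1].
    by rewrite slid_path_end eqxx orbT.
  case: slid_pathP => // [lt_n2|_]; last by rewrite eqxx.
  by rewrite left_side_lpath ?orbT.
have /andP[lj pj] := IHj (ltnW lt_j).
have := iter_rv _ lt_j; have := @scw_back (iter j.+1 f y).
have -> : scw (iter j.+1 f y) = iter j f y by apply: fK.
cbv zeta; rewrite lj !orbT => back nrv.
case: back => //; last by rewrite (negPf nrv).
have yj : fconnect scw y (iter j f y) by rewrite -sfE; apply: fconnect_iter.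
rewrite -(height_same_vertex yj) (height_same_vertex yQ) height_slid //.
by rewrite ltn_subrL lpath_gt0.
Qed.

Lemma rightmost_slid : @rightmost k mt (@nxt k mt h) (nxt h) = rev (map rv p).
Proof.
have -> : @nxt k mt h = Q l by rewrite slid_path_end /= /slide_nxt eqxx.
by rewrite /rightmost dist_slid // rightmost_rec_slid // take_size.
Qed.

(** The new map pairs rev(p_i) with p_{i+1}; sliding along the list of the rev(p_i), in the order of
    p, brings each of them back to p_i. *)
Lemma slide_back_rv (x : m) :
  slide_rv (m := mt) (rev (@rightmost k mt (@nxt k mt h) (nxt h))) x = rv x.
Proof.
rewrite rightmost_slid revK /slide_rv.
have rvI := can_inj rvK.
have mem_rv y : (y \in map rv p) = (rv y \in p) by rewrite -{1}(rvK y) mem_map.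
rewrite !mem_rv /=; case: ifP => prx.
  rewrite -{1}(rvK x) prev_map ?lpath_uniq //.
  rewrite /slide_rv rvK mem_prev prx next_prev ?lpath_uniq //.
  have := @lpath_rv (prev p (rv x)); rewrite mem_prev => /(_ prx) /negPf-> //.
case px: (x \in p).
  by rewrite /slide_rv px rvK mem_prev px next_map ?lpath_uniq // next_prev ?lpath_uniq.
by rewrite slide_rv_other ?px ?prx // rvK px.
Qed.

End LeftSlide.

(* M_left and M_right with arbitrary face labels, so that the mirror symmetry
   exchanges them. *)
Definition slidable k (i0 i1 : 'I_k) (a : 'I_k -> nat) (x : triple k) : Prop :=
  [/\ is_map x a, in_face i0 (tcorner x),
      in_face i1 (thedge x) && half_edge (thedge x) &
      toward (thedge x) (tcorner x)].

Definition coslidable k (i0 i1 : 'I_k) (a : 'I_k -> nat) (x : triple k) : Prop :=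
  [/\ is_map x a, in_face i1 (tcorner x),
      in_face i0 (thedge x) && half_edge (thedge x) &
      away (thedge x) (tcorner x)].

Definition slid_degree k (i0 i1 : 'I_k) (a : 'I_k -> nat) (i : 'I_k) : nat :=
  if i == i0 then a i + 1 else if i == i1 then a i - 1 else a i.

Definition slide_left k (x : triple k) : triple k :=
  slide (leftmost (thedge x) (tcorner x)) (tcorner x) (thedge x).

(** The list is reversed, but not its half-edges: the right construction pairs p_i with
    rev(p_{i+1}), and p_{i+1} precedes p_i in the reversed list. *)
Definition slide_right k (x : triple k) : triple k :=
  slide (rev (rightmost (nxt (thedge x)) (tcorner x))) (tcorner x) (thedge x).

(** * Faces of the slid map *)

Section Faces.
Variables (k : nat) (m : premap k) (a : 'I_k -> nat).
Hypothesis m_map : is_map m a.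

Lemma is_map_rvK : involutive (@rv k m).
Proof. by case: m_map => -[]. Qed.

Lemma is_map_nxt_inj : injective (@nxt k m).
Proof. by case: m_map => -[]. Qed.

Lemma is_map_lab (x : m) : half_edge x = (lab x == None).
Proof. by case: m_map => -[]. Qed.

Lemma is_map_connected : connected m.
Proof. by case: m_map. Qed.

Let nI := is_map_nxt_inj.

Lemma in_face_fconnect i (x y : m) : fconnect nxt x y -> in_face i x = in_face i y.
Proof.
move=> xy; apply: eq_existsb => z; congr (_ && _).
by rewrite !(fconnect_sym nI z); apply: (same_connect (fconnect_sym nI) xy).
Qed.

Lemma in_face_inj i j (x : m) : in_face i x -> in_face j x -> i = j.
Proof.
move=> /existsP[y /andP[/eqP ly yx]] /existsP[z /andP[/eqP lz zx]].
case: m_map => _ [_ /(_ x)[w [_ w_uniq]]] _ _ _.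
have wy : w = y by apply: w_uniq; rewrite ly.
have wz : w = z by apply: w_uniq; rewrite lz.
by move: ly; rewrite -wy wz lz => -[].
Qed.

Variables (i0 i1 : 'I_k) (c h : m).
Hypotheses (i01 : i0 != i1) (c_in : in_face i0 c) (h_in : in_face i1 h).
Hypothesis h_half : half_edge h.

Lemma face_h_c : ~~ fconnect nxt h c.
Proof.
apply/negP=> hc; case/eqP: i01; apply: (in_face_inj c_in).
by rewrite -(in_face_fconnect _ hc).
Qed.

Lemma lab_h : lab h = None.
Proof. by move: h_half; rewrite is_map_lab => /eqP. Qed.

(** The contour of [h] contains a marked corner, which is not a half-edge, so [h] is not alone in
    it. *)
Lemma face_nxt_h : nxt h != h.
Proof.
apply/eqP=> nh; case/existsP: h_in => y /andP[/eqP ly].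
rewrite fconnect_sym // => /iter_findex yE.
have iterE n : iter n nxt h = h by elim: n => //= n ->.
by move: ly; rewrite -yE iterE lab_h.
Qed.

Let n_h := face_nxt_h.
Let cNh : c != h.
Proof. by apply: contraNneq face_h_c => ->; apply: connect0. Qed.
Let nhNc : nxt h != c.
Proof. by apply: contraNneq face_h_c => <-; apply: fconnect1. Qed.

Lemma marked_neq_h (y : m) : lab y <> None -> y != h.
Proof. by move=> ly; apply: contra_notN ly => /eqP->; apply: lab_h. Qed.

Variable p : seq m.
Local Notation mt := (slide_map p c h).

Lemma in_face_slide i (x : m) :
  @in_face k mt i x = in_face i (if x == h then c else x).
Proof.
apply: eq_existsb => y /=; case: eqP => //= ly.
have yh : y != h by apply: marked_neq_h; rewrite ly.
case: eqVneq => [->|xh]; first exact: slide_fconnect_h.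
exact: slide_fconnect.
Qed.

Lemma fcard_slide_nxt : fcard (@nxt k mt) m = fcard (@nxt k m) m.
Proof.
have snI : injective (@nxt k mt) := slide_nxt_inj nI n_h cNh nhNc.
have sym := fconnect_sym nI.
have same_h (x : m) : x != h ->
    fconnect (slide_nxt c h) x h = fconnect nxt x c.
  by move=> xh; apply: slide_fconnect_h.
rewrite (@fcard_image _ _ _ (fun x => froot nxt (if x == h then c else x)) snI).
  rewrite (@fcard_image _ _ _ (froot (@nxt k m)) nI) => [|x y]; last first.
    by rewrite (root_connect sym).
  apply: eq_card => y; apply/imsetP/imsetP => [[x _ ->] | [x _ ->]].
    by exists (if x == h then c else x).
  case: (eqVneq x h) => [->|xh]; last by exists x; rewrite // (negPf xh).
  (* The face that [h] leaves still contains [nxt h], so no face is lost. *)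
  exists (nxt h) => //; rewrite (negPf n_h); apply/(rootP sym).
  exact: fconnect1.
move=> x y; rewrite (root_connect sym).
case: (eqVneq x h) => [->|xh]; case: (eqVneq y h) => [->|yh].
- by rewrite !connect0.
- by rewrite (fconnect_sym snI) same_h // sym.
- exact: same_h.
exact: slide_fconnect.
Qed.

Lemma slide_marked (x : m) : exists! y : m, lab y <> None /\ fconnect (@nxt k mt) y x.
Proof.
case: m_map => _ [_ /(_ (if x == h then c else x))[w [[lw wx] w_uniq]]] _ _ _.
have E (y : m) : lab y <> None -> fconnect (@nxt k mt) y x =
    fconnect nxt y (if x == h then c else x).
  move=> /marked_neq_h yh; case: eqVneq => [->|xh]; first exact: slide_fconnect_h.
  exact: slide_fconnect.
exists w; split=> [|y [ly]]; first by rewrite E.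
by rewrite E // => yx; apply: w_uniq.
Qed.

End Faces.

Section SlideLeftMap.
Variables (k : nat) (a : 'I_k -> nat) (i0 i1 : 'I_k) (x : triple k).
Hypotheses (i01 : i0 != i1) (x_ok : slidable i0 i1 a x).

Local Notation c := (tcorner x).
Local Notation h := (thedge x).

(** The degrees change because [h] leaves the face [i1] for the face [i0]; the numbers of vertices,
    faces and half-edges stay the same. *)
Lemma slide_left_coslidable : coslidable i0 i1 (slid_degree i0 i1 a) (slide_left x).
Proof.
have [m_map c_in /andP[h_in h_half] h_toward] := x_ok.
have rvK := is_map_rvK m_map; have nI := is_map_nxt_inj m_map.
have m_conn := is_map_connected m_map.
have h_c := face_h_c m_map i01 c_in h_in.
have nh := face_nxt_h m_map h_in h_half.
have half_t (z : x) : @half_edge k (slide_map (leftmost h c) c h) z = half_edge z.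
  exact: slid_half_edge.
have face_t := in_face_slide m_map i01 c_in h_in h_half (leftmost h c).
split; last 1 first.
- exact: slid_away.
- split; first split.
  + exact: slid_rvK.
  + exact: slid_nxt_inj.
  + by move=> z; rewrite half_t (is_map_lab m_map).
  + split; first by case: m_map => _ [].
    exact: (slide_marked m_map i01 c_in h_in h_half).
  + exact: slid_connected.
  + rewrite /planar (fcard_scw rvK nI m_conn h_half h_toward h_c nh).
    rewrite (fcard_slide_nxt m_map i01 c_in h_in h_half).
    case: m_map => _ _ _ -> _; congr (_./2 + _); apply: eq_card => z.
    by rewrite !inE half_t.
  move=> i; rewrite /slid_degree /degree.
  have -> : a i = #|[set z : x | in_face i z && half_edge z]|.
    by case: m_map => _ _ _ _ <-.
  have E (z : x) : (z \in [set z : slide_map (leftmost h c) c h |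
      in_face i z && half_edge z]) = in_face i (if z == h then c else z) && half_edge z.
    by rewrite inE face_t half_t.
  have in_h j : in_face j h = (j == i1).
    by apply/idP/eqP => [/(in_face_inj m_map h_in) | ->].
  have in_c j : in_face j c = (j == i0).
    by apply/idP/eqP => [/(in_face_inj m_map c_in) | ->].
  case: (eqVneq i i0) => [ei|ni0]; last case: (eqVneq i i1) => [ei|ni1].
  + rewrite addnC; pose A := [set z : x | in_face i z && half_edge z].
    rewrite -/A; have -> : 1 = (h \notin A).
      by rewrite inE in_h ei (negPf i01).
    rewrite -cardsU1; apply: eq_card => z; rewrite E !inE.
    by case: eqVneq => [->|//]; rewrite in_c ei eqxx h_half.
  + pose A := [set z : x | in_face i z && half_edge z].
    have hA : h \in A by rewrite inE in_h ei eqxx.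
    rewrite -/A (cardsD1 h A) hA addKn.
    apply: eq_card => z; rewrite E !inE.
    by case: eqVneq => [->|//]; rewrite in_c ei eq_sym (negPf i01).
  apply: eq_card => z; rewrite E inE; case: eqVneq => [->|//].
  by rewrite in_h in_c (negPf ni0) (negPf ni1).
- by rewrite /= face_t (negPf nh) -(in_face_fconnect m_map _ (fconnect1 _ _)).
by rewrite /= face_t eqxx c_in half_t.
Qed.

End SlideLeftMap.

(** * Transport along isomorphisms and mirror symmetry *)

Lemma finv_morph (T U : finType) (f : T -> T) (g : U -> U) (u : T -> U) x :
  injective u -> (forall y, u (f y) = g (u y)) -> finv g (u x) = u (finv f x).
Proof.
move=> u_inj ufg; rewrite /finv.
have -> : order g (u x) = order f x.
  by rewrite -!size_orbit (orbit_morph _ u_inj ufg) size_map.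
by elim: (_.-1) => //= n ->.
Qed.

Lemma fcard_morph_image (T U : finType) (f : T -> T) (g : U -> U) (w : T -> U) :
    injective f -> injective g -> bijective w ->
    (forall x y, fconnect g (w x) (w y) = fconnect f x y) ->
  fcard g U = fcard f T.
Proof.
move=> fI gI [v wK vK] fgE; have sym := fconnect_sym gI.
rewrite (@fcard_image _ _ _ (froot g) gI) => [|x y]; last by rewrite (root_connect sym).
rewrite (@fcard_image _ _ _ (froot g \o w) fI) => [|x y]; last first.
  by rewrite /= (root_connect sym) fgE.
apply: eq_card => y; apply/imsetP/imsetP => [[x _ ->] | [x _ ->]].
  by exists (v x); rewrite //= vK.
by exists (w x).
Qed.

Section Transport.
Variables (k : nat) (m1 m2 : premap k) (u : m1 -> m2).
Hypotheses (u_bij : bijective u) (u_rv : {morph u : x / rv x}).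
Hypothesis u_sv : forall x y, same_vertex (u x) (u y) = same_vertex x y.

Lemma half_edge_morph x : half_edge (u x) = half_edge x.
Proof. by rewrite /half_edge -u_rv (inj_eq (bij_inj u_bij)). Qed.

Lemma walk_morph x p y : walk (u x) (map u p) (u y) = walk x p y.
Proof.
by elim: p x => [|h p IHp] x /=; rewrite u_sv // half_edge_morph -IHp u_rv.
Qed.

(** Compatibility with [rv] and with vertices is enough, without [cw]: this also covers mirror
    images, which turn the other way. *)
Lemma dist_morph x y : dist (u x) (u y) = dist x y.
Proof.
have [v uK vK] := u_bij; rewrite /dist (bij_eq_card u_bij); apply: eq_find => n.
apply/existsP/existsP => [[p wp] | [p wp]]; last first.
  by exists (map_tuple u p); rewrite /= walk_morph.
exists (map_tuple v p); rewrite -walk_morph -map_comp.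
by rewrite (eq_map (g := id)) ?map_id // => z /=.
Qed.

Lemma toward_morph x y : toward (u x) (u y) = toward x y.
Proof. by rewrite /toward -u_rv !dist_morph. Qed.

Lemma away_morph x y : away (u x) (u y) = away x y.
Proof. by rewrite /away -u_rv !dist_morph. Qed.

Lemma first_step_morph x y h : first_step (u x) (u y) (u h) = first_step x y h.
Proof.
have [v uK vK] := u_bij; rewrite /first_step dist_morph.
have gE p : geodesic (u x) (map u p) (u y) = geodesic x p y.
  by rewrite /geodesic walk_morph size_map dist_morph.
have hE p : (ohead (map u p) == Some (u h)) = (ohead p == Some h).
  by case: p => //= z p; apply: (inj_eq (bij_inj u_bij)).
apply/existsP/existsP => [[p wp] | [p wp]]; last first.
  by exists (map_tuple u p); rewrite /= gE hE.
exists (map_tuple v p); rewrite -gE -hE -map_comp.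
by rewrite (eq_map (g := id)) ?map_id // => z /=.
Qed.

Lemma connected_morph : connected m1 -> connected m2.
Proof.
have [v uK vK] := u_bij => conn x y; have [p wp] := conn (v x) (v y).
by exists (map u p); rewrite -(vK x) -(vK y) walk_morph.
Qed.

Lemma is_map_morph a :
    injective (@nxt k m2) -> (forall x y, fconnect nxt (u x) (u y) = fconnect nxt x y) ->
    (forall x, lab (u x) = lab x) -> is_map m1 a -> is_map m2 a.
Proof.
move=> n2I u_nxt u_lab [[rvK n1I labE] [lab_ex mark_ex] conn pl deg].
have [v uK vK] := u_bij.
have rvK2 : involutive (@rv k m2) by move=> x; rewrite -(vK x) -!u_rv rvK.
have halfE x : half_edge x = half_edge (v x) by rewrite -half_edge_morph vK.
have faceE i x : in_face i x = in_face i (v x).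
  apply/existsP/existsP => -[y /andP[ly yx]].
    by exists (v y); rewrite -u_lab vK ly -u_nxt !vK.
  by exists (u y); rewrite u_lab ly -(vK x) u_nxt.
split=> [|||| i].
- by split=> // x; rewrite halfE labE -u_lab vK.
- split=> [i | x].
    have [x [lx x_uniq]] := lab_ex i; exists (u x); split; first by rewrite u_lab.
    by move=> y ly; rewrite -(vK y) (x_uniq (v y)) // -u_lab vK.
  have [y [[ly yx] y_uniq]] := mark_ex (v x); exists (u y); split.
    by rewrite u_lab -(vK x) u_nxt.
  move=> z [lz zx]; rewrite -(vK z) (y_uniq (v z)) //.
  by rewrite -u_lab vK -u_nxt !vK.
- exact: connected_morph.
- rewrite /planar (@fcard_morph_image _ _ (@cw k m1) (@cw k m2) u) //; first last.
  + exact: cw_inj.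
  + exact: cw_inj.
  rewrite (@fcard_morph_image _ _ (@nxt k m1) (@nxt k m2) u) // pl.
  congr (_./2 + _); rewrite -(card_imset _ (bij_inj u_bij)); apply: eq_card => x.
  rewrite inE halfE; apply/imsetP/idP => [[y]|hx]; last by exists (v x); rewrite ?inE ?vK.
  by rewrite inE => hy ->; rewrite uK.
rewrite -deg /degree -(card_imset _ (bij_inj u_bij)); apply: eq_card => x.
rewrite inE halfE faceE; apply/idP/imsetP => [hx|[y]].
  by exists (v x); rewrite ?inE ?vK.
by rewrite inE => hy ->; rewrite uK.
Qed.

End Transport.

Section IsoTransport.
Variables (k : nat) (m1 m2 : premap k) (g : m1 -> m2).
Hypotheses (g_bij : bijective g) (g_rv : {morph g : x / rv x}).
Hypothesis (g_nxt : {morph g : x / nxt x}).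
Hypothesis g_lab : forall x, lab (g x) = lab x.

Let g_inj := bij_inj g_bij.

Lemma iso_cw x : g (cw x) = cw (g x).
Proof. by rewrite /cw g_nxt g_rv. Qed.

Lemma iso_sv x y : same_vertex (g x) (g y) = same_vertex x y.
Proof. exact: fconnect_morph g_inj iso_cw x y. Qed.

Lemma iso_in_face i x : in_face i (g x) = in_face i x.
Proof.
have [v gK vK] := g_bij; have gn := fconnect_morph g_inj g_nxt.
apply/existsP/existsP => -[y /andP[ly yx]].
  by exists (v y); rewrite -g_lab vK ly -gn vK.
by exists (g y); rewrite g_lab ly gn.
Qed.

Lemma iso_first_step x y h : first_step (g x) (g y) (g h) = first_step x y h.
Proof. exact: (first_step_morph g_bij g_rv iso_sv). Qed.

Lemma iso_turn f1 f2 (x y t : m1) : (forall z, g (f1 z) = f2 (g z)) ->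
  nth (g x) (orbit f2 (g y)) (find (first_step (g x) (g t)) (orbit f2 (g y))) =
  g (nth x (orbit f1 y) (find (first_step x t) (orbit f1 y))).
Proof.
move=> gf; rewrite (orbit_morph _ g_inj gf) find_map.
set s := orbit f1 y.
have -> : find (preim g (first_step (g x) (g t))) s = find (first_step x t) s.
  by apply: eq_find => z /=; apply: iso_first_step.
have [lt_i|le_i] := ltnP (find (first_step x t) s) (size s); first exact: nth_map.
by rewrite !nth_default ?size_map.
Qed.

Lemma iso_leftmost x t : leftmost (g x) (g t) = map g (leftmost x t).
Proof.
rewrite /leftmost (dist_morph g_bij g_rv iso_sv); move: (dist x t) => n.
elim: n x => //= n IHn x; rewrite (iso_turn _ _ _ iso_cw) -g_nxt IHn //.
Qed.

Lemma iso_rightmost x t : rightmost (g x) (g t) = map g (rightmost x t).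
Proof.
rewrite /rightmost (dist_morph g_bij g_rv iso_sv); move: (dist x t) => n.
have fcw z := esym (finv_morph z g_inj iso_cw).
elim: n x => //= n IHn x; rewrite -fcw (iso_turn _ _ _ fcw) -g_rv IHn //.
Qed.

Lemma iso_slide p c h : uniq p ->
  iso (slide p c h) (slide (map g p) (g c) (g h)).
Proof.
move=> up; exists g; split=> //; last exact: g_nxt.
split=> // z /=.
  rewrite /slide_rv mem_map //; case: ifP => _; first by rewrite g_rv prev_map.
  by rewrite -g_rv mem_map //; case: ifP => _; rewrite ?next_map.
rewrite /slide_nxt -!g_nxt !(inj_eq g_inj).
by case: ifP => // _; case: ifP => // _; case: ifP.
Qed.

End IsoTransport.

Section Iso.
Variables (k : nat).
Implicit Types (x y z : triple k).

Lemma iso_trans y x z : iso x y -> iso y z -> iso x z.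
Proof.
move=> [f [fb [frv fn fl] fc fh]] [g [gb [grv gn gl] gc gh]].
exists (g \o f); split; rewrite /= ?fc ?fh //; first exact: bij_comp.
by split=> w /=; rewrite ?frv ?grv ?fn ?gn ?gl ?fl.
Qed.

Lemma iso_sym x y : iso x y -> iso y x.
Proof.
move=> [f [fb [frv fn fl] fc fh]]; have [g fK gK] := fb; exists g; split.
- by exists f.
- by split=> w; rewrite -{1}(gK w) -?frv -?fn ?fK // -fl gK.
- by rewrite -fc fK.
by rewrite -fh fK.
Qed.

Lemma iso_nxt_inj x y : iso x y -> injective (@nxt k x) -> injective (@nxt k y).
Proof.
move=> [g [gb [_ gn _] _ _]] nI w w'; have [v gK vK] := gb.
by rewrite -(vK w) -(vK w') -!gn => /(bij_inj gb) /nI ->.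
Qed.

Lemma iso_is_map a x y : iso x y -> is_map x a -> is_map y a.
Proof.
move=> xy m_map; have nI := iso_nxt_inj xy (is_map_nxt_inj m_map).
have [g [gb [grv gn gl] _ _]] := xy.
apply: (is_map_morph gb grv (iso_sv gb grv gn) nI _ gl m_map).
exact: fconnect_morph (bij_inj gb) gn.
Qed.

Lemma iso_coslidable i0 i1 a x y : iso x y ->
  coslidable i0 i1 a x -> coslidable i0 i1 a y.
Proof.
move=> xy [m_map c_in h_in h_away]; split; first exact: iso_is_map m_map.
all: have [g [gb [grv gn gl] gc gh]] := xy; rewrite -?gc -?gh.
- by rewrite iso_in_face.
- by rewrite iso_in_face // half_edge_morph.
by rewrite away_morph //; apply: iso_sv.
Qed.

Lemma iso_slidable i0 i1 a x y : iso x y ->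
  slidable i0 i1 a x -> slidable i0 i1 a y.
Proof.
move=> xy [m_map c_in h_in h_toward]; split; first exact: iso_is_map m_map.
all: have [g [gb [grv gn gl] gc gh]] := xy; rewrite -?gc -?gh.
- by rewrite iso_in_face.
- by rewrite iso_in_face // half_edge_morph.
by rewrite toward_morph //; apply: iso_sv.
Qed.

Lemma leftmost_uniq a x (e f : x) : is_map x a -> uniq (leftmost e f).
Proof.
move=> m_map; have rvK := is_map_rvK m_map; have nI := is_map_nxt_inj m_map.
have conn := is_map_connected m_map.
exact: (geodesic_uniq rvK nI conn (leftmost_geodesic rvK nI conn e f)).
Qed.

Lemma rightmost_uniq a x (e f : x) : is_map x a -> uniq (rightmost e f).
Proof.
move=> m_map; have rvK := is_map_rvK m_map; have nI := is_map_nxt_inj m_map.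
have conn := is_map_connected m_map.
exact: (geodesic_uniq rvK nI conn (rightmost_geodesic rvK nI conn e f)).
Qed.

Lemma iso_slide_left a x y : is_map x a -> iso x y -> iso (slide_left x) (slide_left y).
Proof.
move=> m_map [g [gb [grv gn gl] gc gh]]; rewrite /slide_left -gc -gh.
rewrite (iso_leftmost gb grv gn); apply: iso_slide => //.
exact: leftmost_uniq m_map.
Qed.

Lemma iso_slide_right a x y :
  is_map x a -> iso x y -> iso (slide_right x) (slide_right y).
Proof.
move=> m_map [g [gb [grv gn gl] gc gh]]; rewrite /slide_right -gc -gh -gn.
rewrite (iso_rightmost gb grv gn) -map_rev; apply: iso_slide => //.
by rewrite rev_uniq; apply: rightmost_uniq m_map.
Qed.

(** Both slides keep the elements of the map, so the isomorphism is the identity. *)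
Lemma slide_leftK i0 i1 a x : i0 != i1 -> slidable i0 i1 a x ->
  iso (slide_right (slide_left x)) x.
Proof.
move=> i01 [m_map c_in /andP[h_in h_half] h_toward].
have rvK := is_map_rvK m_map; have nI := is_map_nxt_inj m_map.
have m_conn := is_map_connected m_map.
have h_c := face_h_c m_map i01 c_in h_in.
have nh := face_nxt_h m_map h_in h_half.
exists id; split=> //; first by exists id.
- split=> // z /=.
    exact: (slide_back_rv rvK nI m_conn h_half h_toward h_c nh z).
  exact: slide_nxtK.
by rewrite /= /slide_nxt eqxx.
Qed.

End Iso.

(** * Mirror images, which exchange leftmost and rightmost geodesics *)

Section MirrorMap.
Variables (k : nat) (m : premap k).

(* The half-edge h of m is the half-edge rev(h) of its mirror image, so that
   both have the same face on their left. *)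
Definition mirror_map : premap k := @Premap k m rv (finv nxt) lab.

Hypotheses (rvK : involutive (@rv k m)) (nxt_inj : injective (@nxt k m)).
Local Notation mm := mirror_map.
Local Notation cwm := (@cw k m).
Let rv' : mm -> m := fun x => @rv k m x.

Lemma mirror_rv_bij : bijective rv'.
Proof. by exists (@rv k m). Qed.

Lemma mirror_rv_morph : {morph rv' : x / rv x}.
Proof. by []. Qed.

Lemma mirror_cw (x : mm) : rv' (cw x) = finv cwm (rv' x).
Proof. by rewrite finv_cw. Qed.

Lemma mirror_sv (x y : mm) : same_vertex (rv' x) (rv' y) = same_vertex x y.
Proof.
rewrite /same_vertex -(same_fconnect_finv (cw_inj rvK nxt_inj)).
exact: fconnect_morph (bij_inj mirror_rv_bij) mirror_cw x y.
Qed.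

Lemma mirror_dist (x y : mm) : dist x y = @dist k m (rv x) (rv y).
Proof. by rewrite -(dist_morph mirror_rv_bij mirror_rv_morph mirror_sv). Qed.

Lemma mirror_nxt_inj : injective (@nxt k mm).
Proof. exact: finv_inj. Qed.

Lemma mirror_connected : connected m -> connected mm.
Proof.
apply: (@connected_morph k m mm (@rv k m)) => // [|x y]; first by exists (@rv k m).
by rewrite -mirror_sv /rv' !rvK.
Qed.

Lemma mirror_in_face i (x : m) : @in_face k mm i x = in_face i x.
Proof.
by apply: eq_existsb => y /=; rewrite (same_fconnect_finv nxt_inj).
Qed.

Lemma mirror_is_map a : is_map m a -> is_map mm a.
Proof.
move=> [[_ _ labE] [lab_ex mark_ex] conn pl deg]; split.
- by split; [| exact: mirror_nxt_inj |].
- split=> // x; have [y [[ly yx] y_uniq]] := mark_ex x; exists y; split.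
    by rewrite (same_fconnect_finv nxt_inj).
  by move=> z; rewrite (same_fconnect_finv nxt_inj); apply: y_uniq.
- exact: mirror_connected.
- rewrite /planar /= fcard_finv // -pl.
  rewrite (@fcard_morph_image _ _ (@cw k mm) cwm rv') //.
  + exact: (cw_inj (m := mm) rvK mirror_nxt_inj).
  + exact: cw_inj.
  + exact: mirror_rv_bij.
  exact: mirror_sv.
move=> i; rewrite -deg; apply: eq_card => x; rewrite !inE mirror_in_face //.
Qed.

Hypothesis conn : connected m.

Lemma finv_nxt_sv (x : m) : same_vertex (rv (finv nxt x)) x.
Proof.
by rewrite -finv_cw // (same_vertex_sym rvK nxt_inj); apply: fconnect_finv.
Qed.

Lemma mirror_first_step (x t : m) (z : mm) :
  first_step (finv nxt x : mm) (finv nxt t) z = first_step x t (rv' z).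
Proof.
rewrite (first_stepE (m := mm) rvK mirror_nxt_inj (mirror_connected conn)).
rewrite (first_stepE rvK nxt_inj conn) half_edge_rv // -mirror_sv !mirror_dist.
rewrite -(same_vertex_eql rvK nxt_inj _ (finv_nxt_sv x)).
by rewrite -!(dist_eqr rvK nxt_inj _ (finv_nxt_sv t)).
Qed.

Lemma mirror_leftmost (x t : m) :
  rightmost x t = map rv' (leftmost (finv nxt x : mm) (finv nxt t)).
Proof.
rewrite /rightmost /leftmost mirror_dist.
rewrite (dist_eql rvK nxt_inj _ (finv_nxt_sv x)) (dist_eqr rvK nxt_inj _ (finv_nxt_sv t)).
move dx: (dist x t) => n; elim: n x dx => //= n IHn x dx.
set s := orbit (finv cwm) _; set s' := orbit _ (finv nxt x).
have eq_s : s = map rv' s'.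
  by rewrite /s finv_cw // -(orbit_morph _ (bij_inj mirror_rv_bij) mirror_cw).
have eq_find : find (first_step x t) s =
    find (first_step (finv nxt x : mm) (finv nxt t)) s'.
  by rewrite eq_s find_map; apply: eq_find => z /=; rewrite mirror_first_step.
set h := nth x s _; set h' := nth _ s' _.
have sh : first_step x t h.
  apply: (turning_first_step rvK nxt_inj conn); rewrite ?dx //.
    exact: fconnect_finv.
  exact: (same_fconnect_finv (cw_inj rvK nxt_inj)).
(* The default values of the two searches do not correspond, so the search has to be successful,
   which [sh] provides. *)
have eq_h : h = rv' h'.
  rewrite /h /h' eq_find eq_s (nth_map (finv nxt x)) // -eq_find -(size_map rv') -eq_s.
  rewrite -has_find; apply/hasP; exists h => //; rewrite /s -fconnect_orbit.
  rewrite (same_fconnect_finv (cw_inj rvK nxt_inj)).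
  move: sh; rewrite (first_stepE rvK nxt_inj conn) => /and3P[_ + _].
  by apply: connect_trans; rewrite (fconnect_sym (cw_inj rvK nxt_inj)) fconnect_finv.
congr (_ :: _) => //; rewrite IHn; first by rewrite eq_h /rv' rvK.
exact: (first_step_dist rvK nxt_inj conn dx sh).
Qed.

End MirrorMap.

Section MirrorTriple.
Variables (k : nat).
Implicit Types x y z : triple k.

(** A corner is named after the element that follows it in the contour; when contours are reversed,
    this becomes the element that preceded it. *)
Definition mirror x : triple k :=
  @Triple k (mirror_map x) (finv nxt (tcorner x)) (thedge x).

Lemma mirrorK x : injective (@nxt k x) -> iso (mirror (mirror x)) x.
Proof.
move=> nI; exists id; split=> //=; first by exists id.
  by split=> // z /=; rewrite finv_inv.
by rewrite finv_inv // f_finv.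
Qed.

Lemma iso_mirror x y : iso x y -> iso (mirror x) (mirror y).
Proof.
move=> [g [gb [grv gn gl] gc gh]]; exists g; split=> //=.
  by split=> // z /=; rewrite (finv_morph _ (bij_inj gb) gn).
by rewrite -gc (finv_morph _ (bij_inj gb) gn).
Qed.

Lemma mirror_slidable i0 i1 a x : coslidable i0 i1 a x -> slidable i1 i0 a (mirror x).
Proof.
move=> [m_map c_in /andP[h_in h_half] h_away].
have rvK := is_map_rvK m_map; have nI := is_map_nxt_inj m_map.
split=> /=.
- exact: mirror_is_map.
- have cE : fconnect nxt (finv nxt (tcorner x)) (tcorner x).
    by rewrite (fconnect_sym nI) fconnect_finv.
  by rewrite mirror_in_face // (in_face_fconnect m_map _ cE).
- by rewrite mirror_in_face // h_in.
rewrite /toward !mirror_dist //= !(dist_eqr rvK nI _ (finv_nxt_sv rvK nI _)).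
by rewrite rvK.
Qed.

(** In the mirror image, the rightmost geodesic R_1, ..., R_l reads rev(R_1), ..., rev(R_l), and the
    slide pairs rev(R_i) with R_{i-1}. This is also the pairing of the slide along the reversed
    list. *)
Lemma slide_right_mirror i0 i1 a x : i0 != i1 -> coslidable i0 i1 a x ->
  iso (slide_right x) (mirror (slide_left (mirror x))).
Proof.
move=> i01 x_ok; have x'_ok := mirror_slidable x_ok.
have [m_map c_in /andP[h_in h_half] h_away] := x_ok.
have rvK := is_map_rvK m_map; have nI := is_map_nxt_inj m_map.
have conn := is_map_connected m_map.
set c := tcorner x in c_in h_away *; set h := thedge x in h_in h_half h_away *.
have i10 : i1 != i0 by rewrite eq_sym.
have h_c : ~~ fconnect nxt h c.
  by rewrite fconnect_sym //; apply: (face_h_c m_map i01 h_in c_in).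
have nh := face_nxt_h m_map h_in h_half.
have cNh : c != h by apply: contraNneq h_c => ->; apply: connect0.
have nhNc : nxt h != c by apply: contraNneq h_c => <-; apply: fconnect1.
have PE := mirror_leftmost rvK nI conn (nxt h) c; rewrite finv_f // in PE.
pose p' := leftmost (h : mirror_map x) (finv nxt c).
have p'E : p' = map rv (rightmost (nxt h) c).
  by rewrite PE -map_comp (eq_map (g := id)) ?map_id // => z /=; rewrite rvK.
have uR := rightmost_uniq (nxt h) c m_map.
have gR := rightmost_geodesic rvK nI conn (nxt h) c.
have rvR := geodesic_rv rvK nI conn gR.
have rvI := can_inj rvK.
pose N : x -> x := slide_nxt (m := mirror_map x) (finv nxt c) h.
have fnI := finv_inj nI.
have fn_eq (z w : x) : (finv nxt z == w) = (z == nxt w).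
  by rewrite -(inj_eq nI) f_finv.
have NE (z : x) : N z = if z == h then finv nxt c else
    if z == nxt h then finv nxt h else if z == c then h else finv nxt z.
  by rewrite /N /slide_nxt /= !fn_eq f_finv.
have NI : injective N.
  apply: (slide_nxt_inj (m := mirror_map x) fnI).
  - by rewrite /= fn_eq eq_sym.
  - by rewrite fn_eq eq_sym.
  by rewrite (inj_eq fnI) eq_sym.
exists id; split=> //=; first by exists id.
- split=> // z /=.
    rewrite /slide_rv /= -/h -/c -/p' p'E !mem_rev prev_rev // next_rev //.
    have memE w : (w \in map rv (rightmost (nxt h) c)) = (rv w \in rightmost (nxt h) c).
      by rewrite -{1}(rvK w) (mem_map rvI).
    rewrite !memE rvK; case: ifP => [zR|_]; last first.
      case: ifP => // zR; rewrite -{2}(rvK z) prev_map // rvK //.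
    by rewrite (negPf (rvR _ zR)) next_map.
  (* The contours on the right-hand side are the inverse of [N]; applying [N] to both sides avoids
     describing that inverse. *)
  apply: (NI _ _); rewrite -/h -/c [RHS](f_finv NI) NE /slide_nxt -/h -/c.
  case: (eqVneq z h) => [->|zh]; first by rewrite (negPf cNh) eq_sym (negPf nhNc) eqxx.
  case: (eqVneq (nxt z) h) => [e|zh'].
    by rewrite (negPf nh) eqxx -e finv_f.
  case: (eqVneq (nxt z) c) => [e|zc]; first by rewrite eqxx -e finv_f.
  by rewrite (negPf zh') (inj_eq nI) (negPf zh) (negPf zc) finv_f.
apply: (NI _ _); rewrite -/h -/c [RHS](f_finv NI) NE (negPf nh) eqxx //.
Qed.

Lemma slide_right_slidable i0 i1 a x : i0 != i1 -> coslidable i0 i1 a x ->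
  slidable i0 i1 (slid_degree i1 i0 a) (slide_right x).
Proof.
move=> i01 x_ok; apply: iso_slidable (iso_sym (slide_right_mirror i01 x_ok)) _.
apply/mirror_slidable/slide_left_coslidable; first by rewrite eq_sym.
exact: mirror_slidable.
Qed.

(** With S for [slide_left] and J for [mirror], [slide_right] is JSJ up to isomorphism, and S(JSJ)
    is J(JSJ)SJ; the factor (JSJ)S cancels by [slide_leftK], leaving JJ. *)
Lemma slide_rightK i0 i1 a x : i0 != i1 -> coslidable i0 i1 a x ->
  iso (slide_left (slide_right x)) x.
Proof.
move=> i01 x_ok; have i10 : i1 != i0 by rewrite eq_sym.
have y_ok := mirror_slidable x_ok.
have z_ok := slide_left_coslidable i10 y_ok.
have zx := iso_trans (iso_sym (slide_right_mirror i10 z_ok)) (slide_leftK i10 y_ok).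
have [w_map _ _ _] := slide_right_slidable i01 x_ok.
apply: iso_trans (iso_slide_left w_map (slide_right_mirror i01 x_ok)) _.
set z := slide_left (mirror x) in z_ok zx *.
have [m_map _ _ _] := x_ok; have nI := is_map_nxt_inj m_map.
have [z'_map _ _ _] := slide_left_coslidable i01 (mirror_slidable z_ok).
apply: iso_trans (iso_sym (mirrorK (is_map_nxt_inj z'_map))) _.
exact: iso_trans (iso_mirror zx) (mirrorK nI).
Qed.

End MirrorTriple.

(** * Removal of elements *)

Section Removal.
Variables (k : nat) (m : premap k).
Implicit Types (s : seq m) (x y : m).

Lemma skip_iter s x n : n < #|m| ->
    (forall j, j < n -> iter j.+1 nxt x \in s) -> iter n.+1 nxt x \notin s ->
  skip s x = iter n.+1 nxt x.
Proof.
move=> lt_n before last_n; rewrite /skip.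
have nthE i : i < #|m| -> nth x (traject nxt (nxt x) #|m|) i = iter i.+1 nxt x.
  by move=> lt_i; rewrite (set_nth_default (nxt x)) ?size_traject // nth_traject // iterSr.
suff -> : find (fun y => y \notin s) (traject nxt (nxt x) #|m|) = n by rewrite nthE.
apply/eqP; rewrite eqn_leq; apply/andP; split.
  rewrite leqNgt; apply/negP=> /(before_find x) /negbT; rewrite nthE //.
  by rewrite negbK => /(negP last_n).
rewrite leqNgt; apply/negP=> lt_f; have lt_fm := ltn_trans lt_f lt_n.
have := @nth_find _ x (fun y => y \notin s) (traject nxt (nxt x) #|m|).
by rewrite has_find size_traject lt_fm nthE // before // => /(_ isT).
Qed.

Lemma skip1 s x : nxt x \notin s -> skip s x = nxt x.
Proof. by move=> nx; apply: (@skip_iter _ _ 0) => //; apply/card_gt0P; exists x. Qed.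

(** Meant for a dangling edge, whose two half-edges are consecutive in a contour; distinctness makes
    the map large enough for the search bound in [skip]. *)
Lemma skip3 s x y z t : uniq [:: x; y; z] -> y \in s -> z \in s -> t \notin s ->
  nxt x = y -> nxt y = z -> nxt z = t -> skip s x = t.
Proof.
move=> uxyz ys zs ts xy yz zt; rewrite -zt -yz -xy.
apply: (@skip_iter _ _ 2); rewrite /= ?xy ?yz ?zt //.
  by rewrite -[3]/(size [:: x; y; z]) -(card_uniqP uxyz) max_card.
by case=> [|[|j]] //= _; rewrite ?xy ?yz.
Qed.

Lemma val_remove_rv s (w : remove s) :
  rv (val w) \notin s -> val (rv w) = rv (val w).
Proof. by move=> nw; rewrite val_insubd nw. Qed.

Lemma val_remove_nxt s (w : remove s) :
  skip s (val w) \notin s -> val (nxt w) = skip s (val w).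
Proof. by move=> nw; rewrite val_insubd nw. Qed.

End Removal.

(** The embedding [G] describes what deletion leaves as the complement of the two sides of [d]; its
    corestriction is the isomorphism. *)
Lemma delete_iso k (m m' : premap k) (c h : m') (d : m) (G : m' -> m) :
    injective G -> (forall x, G x \notin [:: d; rv d]) ->
    (forall z, z \notin [:: d; rv d] -> exists x, z = G x) ->
    {morph G : x / rv x} -> (forall x, skip [:: d; rv d] (G x) = G (nxt x)) ->
    (forall x, lab (G x) = lab x) -> dangling d -> nxt d = G c ->
  exists2 y, delete_dangling d (G h) = Some y & iso y (@Triple k m' c h).
Proof.
move=> G_inj G_kept G_onto G_rv G_nxt G_lab d_dang d_nxt.
rewrite /delete_dangling d_dang d_nxt.
rewrite (insubT (fun x => x \notin [:: d; rv d]) (G_kept c)).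
rewrite (insubT (fun x => x \notin [:: d; rv d]) (G_kept h)).
eexists; first reflexivity; apply: iso_sym.
exists (fun x => Sub (G x) (G_kept x) : remove [:: d; rv d]); split.
- have G_inv (w : remove [:: d; rv d]) : exists x, G x == val w.
    by have [x ->] := G_onto _ (valP w); exists x.
  exists (fun w => xchoose (G_inv w)) => [x | w].
    by apply: G_inj; apply/eqP; rewrite (eqP (xchooseP (G_inv _))).
  by apply: val_inj; apply/eqP; rewrite /= (eqP (xchooseP (G_inv _))).
- split=> x.
  + have E := @val_remove_rv k m [:: d; rv d] (Sub (G x) (G_kept x)).
    by apply: val_inj; rewrite E SubK -G_rv ?SubK.
  + have E := @val_remove_nxt k m [:: d; rv d] (Sub (G x) (G_kept x)).
    by apply: val_inj; rewrite E SubK G_nxt ?SubK.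
  exact: G_lab.
- exact: val_inj.
exact: val_inj.
Qed.

(** * Slitting and sewing *)

Section SlitSew.
Variables (k : nat) (m : premap k) (e f : m) (p : seq m) (n : nat).
Hypotheses (rvK : involutive (@rv k m)).
Hypotheses (p_uniq : uniq p) (p_rv : forall x, x \in p -> rv x \notin p).
Hypothesis size_p : size p = n.+1.

Local Notation S := (slit e f p).
Local Notation O := (old p).
Local Notation L := (lcorner e p).
Local Notation R := (rcorner f p).
Local Notation P := (nth e p).

Lemma ord_p i : i <= n -> i < size p.
Proof. by rewrite size_p. Qed.

(** Lips are handled through [L] and [R], indexed by natural numbers; [L 0] and [R n.+1] are the old
    corners at the two ends of the slit. *)
Lemma lcornerS i (lt_i : i < size p) : L i.+1 = llip (Ordinal lt_i).
Proof. by rewrite /lcorner insubT. Qed.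

Lemma rcornerE i (lt_i : i < size p) : R i = rlip (Ordinal lt_i).
Proof. by rewrite /rcorner insubT. Qed.

Lemma rcorner_last : R n.+1 = O f.
Proof. by rewrite /rcorner insubF // size_p ltnn. Qed.

Lemma lcorner_old i x : i <= n -> (L i.+1 == O x) = false.
Proof. by move=> le_i; rewrite (lcornerS (ord_p le_i)). Qed.

Lemma rcorner_old i x : i <= n -> (R i == O x) = false.
Proof. by move=> le_i; rewrite (rcornerE (ord_p le_i)). Qed.

Lemma lcorner_rcorner i j : i <= n -> (L i.+1 == R j) = false.
Proof.
move=> le_i; rewrite (lcornerS (ord_p le_i)) /rcorner.
by case: insubP.
Qed.

Lemma lcorner_eq i j : i <= n -> j <= n -> (L i.+1 == L j.+1) = (i == j).
Proof.
by move=> le_i le_j; rewrite (lcornerS (ord_p le_i)) (lcornerS (ord_p le_j)).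
Qed.

Lemma rcorner_eq i j : i <= n -> j <= n -> (R i == R j) = (i == j).
Proof.
by move=> le_i le_j; rewrite (rcornerE (ord_p le_i)) (rcornerE (ord_p le_j)).
Qed.

Lemma old_eq x y : (O x == O y) = (x == y).
Proof. by []. Qed.

Lemma slit_nxt_old x : slit_nxt e f (O x) =
  if nxt x == e then R 0 else if nxt x == f then L n.+1 else O (nxt x).
Proof. by have <- : L (size p) = L n.+1 by congr (lcorner e p _). Qed.

Lemma slit_nxt_lcorner i : i <= n -> slit_nxt e f (L i.+1) = L i.
Proof. by move=> le_i; rewrite (lcornerS (ord_p le_i)). Qed.

Lemma slit_nxt_rcorner i : i <= n -> slit_nxt e f (R i) = R i.+1.
Proof. by move=> le_i; rewrite (rcornerE (ord_p le_i)). Qed.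

Lemma slit_rv_path i : i <= n -> slit_rv (O (P i)) = L i.+1.
Proof.
move=> le_i; have lt_i := ord_p le_i.
by rewrite /slit_rv /= index_uniq // insubT -lcornerS.
Qed.

Lemma slit_rv_rev i : i <= n -> slit_rv (O (rv (P i))) = R i.
Proof.
move=> le_i; have lt_i := ord_p le_i.
rewrite /slit_rv /= insubF; last first.
  by rewrite index_mem; apply/negbTE/p_rv/mem_nth.
by rewrite rvK index_uniq // insubT -rcornerE.
Qed.

Lemma slit_rv_other x : x \notin p -> rv x \notin p -> slit_rv (O x) = O (rv x).
Proof.
by move=> px prx; rewrite /slit_rv /= !insubF // index_mem; apply/negbTE.
Qed.

Lemma slit_rv_lcorner i : i <= n -> slit_rv (L i.+1) = O (P i).
Proof.
move=> le_i; rewrite (lcornerS (ord_p le_i)) /= (tnth_nth e) //.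
Qed.

Lemma slit_rv_rcorner i : i <= n -> slit_rv (R i) = O (rv (P i)).
Proof.
move=> le_i; rewrite (rcornerE (ord_p le_i)) /= (tnth_nth e) //.
Qed.

Lemma slit_cases (z : S) :
  [\/ exists x, z = O x, exists2 i, i <= n & z = L i.+1 | exists2 i, i <= n & z = R i].
Proof.
case: z => [x | [i | i]]; first by constructor 1; exists x.
  constructor 2; exists i; first by rewrite -ltnS -size_p.
  by rewrite (lcornerS (ltn_ord i)); congr (inr (inl _)); apply: val_inj.
constructor 3; exists i; first by rewrite -ltnS -size_p.
by rewrite (rcornerE (ltn_ord i)); congr (inr (inr _)); apply: val_inj.
Qed.

Lemma card_slit : #|S| = #|m| + (n.+1 + n.+1).
Proof. by rewrite !card_sum !card_ord size_p. Qed.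

Section Sewing.
(* [al = 1] and [be = 0] for the left construction, [al = 0] and [be = 1] for
   the right one. *)
Variables (al be j j' : nat).
Hypotheses (al_be : al + be = 1) (jE : j = n + al) (j'E : j' = n + be).

Local Notation u := (subpath (left_copy e f p) al.+1 j).
Local Notation v := (subpath (right_copy e f p) be.+1 j').
Local Notation sewn := (sewn_lips e f p al.+1 j be.+1 j').
Local Notation srv := (@sew_rv k m e f p al.+1 j be.+1 j').

Let le_al : al <= 1. Proof. by rewrite -al_be leq_addr. Qed.
Let le_be : be <= 1. Proof. by rewrite -al_be leq_addl. Qed.

Lemma add_al i : i < n -> i + al <= n.
Proof. by move=> lt_i; apply: leq_trans (leq_add (leqnn i) le_al) _; rewrite addn1. Qed.

Lemma add_be i : i < n -> i + be <= n.
Proof. by move=> lt_i; apply: leq_trans (leq_add (leqnn i) le_be) _; rewrite addn1. Qed.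

Lemma sewn_left : u = mkseq (fun i => O (P (i + al))) n :> seq S.
Proof.
rewrite /subpath jE /=; have le_p : n + al <= size p.
  by rewrite size_p -addn1 leq_add2l.
have sz : size (drop al (take (n + al) (left_copy e f p))) = n.
  by rewrite size_drop size_take_min size_map (minn_idPl le_p) addnK.
apply: (@eq_from_nth _ (O e)); rewrite sz ?size_mkseq // => i lt_i.
rewrite nth_drop nth_take 1?addnC ?ltn_add2r // (nth_map e) ?nth_mkseq //.
by rewrite size_p ltnS add_al.
Qed.

Lemma nth_right_copy d i : i <= n -> nth d (right_copy e f p) i = R i.
Proof.
move=> le_i; have lt_i := ord_p le_i.
rewrite (nth_map (Ordinal lt_i)) ?size_enum_ord // (rcornerE lt_i).
by congr (rlip _); apply: val_inj; rewrite /= nth_enum_ord.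
Qed.

Lemma sewn_right : v = mkseq (fun i => R (i + be)) n :> seq S.
Proof.
rewrite /subpath j'E /=; have le_p : n + be <= size p.
  by rewrite size_p -addn1 leq_add2l.
have sz : size (drop be (take (n + be) (right_copy e f p))) = n.
  by rewrite size_drop size_take_min size_map size_enum_ord (minn_idPl le_p) addnK.
apply: (@eq_from_nth _ (O e)); rewrite sz ?size_mkseq // => i lt_i.
rewrite nth_drop nth_take 1?addnC ?ltn_add2r // nth_right_copy ?add_be //.
by rewrite nth_mkseq.
Qed.

Lemma mem_sewn_left z : reflect (exists2 i, i < n & z = O (P (i + al))) (z \in u).
Proof.
rewrite sewn_left; apply: (iffP mapP) => -[i].
  by rewrite mem_iota => lt_i ->; exists i.
by move=> lt_i ->; exists i; rewrite ?mem_iota.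
Qed.

Lemma mem_sewn_right z : reflect (exists2 i, i < n & z = R (i + be)) (z \in v).
Proof.
rewrite sewn_right; apply: (iffP mapP) => -[i].
  by rewrite mem_iota => lt_i ->; exists i.
by move=> lt_i ->; exists i; rewrite ?mem_iota.
Qed.

Lemma index_sewn_left i : i < n -> index (O (P (i + al))) u = i.
Proof.
move=> lt_i; have uu : uniq u.
  by rewrite drop_uniq // take_uniq // map_inj_uniq // => x y [].
have sz : size u = n by rewrite sewn_left size_mkseq.
by rewrite -[RHS](index_uniq (O e) _ uu) ?sz // sewn_left nth_mkseq.
Qed.

Lemma index_sewn_right i : i < n -> index (R (i + be)) v = i.
Proof.
move=> lt_i; have uv : uniq v.
  by rewrite drop_uniq // take_uniq // map_inj_uniq ?enum_uniq // => x y [].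
have sz : size v = n by rewrite sewn_right size_mkseq.
by rewrite -[RHS](index_uniq (O e) _ uv) ?sz // sewn_right nth_mkseq.
Qed.

Lemma old_sewn x : O x \notin sewn.
Proof.
rewrite mem_cat negb_or; apply/andP; split; apply/negP.
  case/mapP=> z /mem_sewn_left[i lt_i ->] /eqP.
  by rewrite [rv _]slit_rv_path ?add_al // eq_sym lcorner_old ?add_al.
case/mem_sewn_right=> i lt_i /eqP.
by rewrite eq_sym rcorner_old ?add_be.
Qed.

Lemma lcorner_sewn i : i <= n -> (L i.+1 \in sewn) = (al <= i < n + al).
Proof.
move=> le_i; rewrite mem_cat; apply/orP/andP => [[]|[al_i i_al]].
- case/mapP=> z /mem_sewn_left[i' lt_i ->] /eqP.
  rewrite [rv _]slit_rv_path ?add_al // lcorner_eq ?add_al // => /eqP->.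
  by rewrite leq_addl ltn_add2r.
- by case/mem_sewn_right=> i' lt_i /eqP; rewrite lcorner_rcorner.
left; apply/mapP; exists (O (P i)); last by rewrite [rv _]slit_rv_path.
by apply/mem_sewn_left; exists (i - al); rewrite ?subnK // ltn_subLR // addnC.
Qed.

Lemma rcorner_sewn i : i <= n -> (R i \in sewn) = (be <= i < n + be).
Proof.
move=> le_i; rewrite mem_cat; apply/orP/andP => [[]|[be_i i_be]].
- case/mapP=> z /mem_sewn_left[i' lt_i ->] /eqP.
  by rewrite [rv _]slit_rv_path ?add_al // eq_sym lcorner_rcorner ?add_al.
- case/mem_sewn_right=> i' lt_i /eqP; rewrite rcorner_eq ?add_be // => /eqP->.
  by rewrite leq_addl ltn_add2r.
right; apply/mem_sewn_right; exists (i - be); rewrite ?subnK //.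
by rewrite ltn_subLR // addnC.
Qed.

Lemma sew_rv_path i : i < n -> srv (O (P (i + al))) = O (rv (P (i + be))).
Proof.
move=> lt_i; rewrite /sew_rv; have -> : O (P (i + al)) \in u.
  by apply/mem_sewn_left; exists i.
rewrite index_sewn_left // sewn_right nth_mkseq //.
by rewrite [LHS]slit_rv_rcorner ?add_be.
Qed.

Lemma rev_notin_sewn i z : i <= n -> z = O (rv (P i)) -> (z \in u) = false.
Proof.
move=> le_i ->; apply/negP=> /mem_sewn_left[i' lt_i /eqP]; rewrite old_eq => /eqP e1.
have := p_rv (mem_nth e (ord_p le_i)); rewrite e1 mem_nth //.
by rewrite size_p ltnS add_al.
Qed.

Lemma sew_rv_rev i : i < n -> srv (O (rv (P (i + be)))) = O (P (i + al)).
Proof.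
move=> lt_i; have le_i := add_be lt_i.
rewrite /sew_rv (rev_notin_sewn le_i) // [rv _]slit_rv_rev //.
have -> : R (i + be) \in v by apply/mem_sewn_right; exists i.
by rewrite index_sewn_right // sewn_left nth_mkseq.
Qed.

Lemma sew_rv_path_kept i : i <= n -> ~~ (al <= i < n + al) -> srv (O (P i)) = L i.+1.
Proof.
move=> le_i ni; rewrite /sew_rv.
have -> : (O (P i) \in u) = false.
  apply/negP=> /mem_sewn_left[i' lt_i /eqP]; rewrite old_eq.
  rewrite nth_uniq // ?ord_p ?add_al // => /eqP ei.
  by move: ni; rewrite ei leq_addl ltn_add2r lt_i.
rewrite [rv _]slit_rv_path //.
by case: mem_sewn_right => // -[i' lt_i /eqP]; rewrite lcorner_rcorner.
Qed.

Lemma sew_rv_rev_kept i : i <= n -> ~~ (be <= i < n + be) ->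
  srv (O (rv (P i))) = R i.
Proof.
move=> le_i ni; rewrite /sew_rv (rev_notin_sewn le_i) // [rv _]slit_rv_rev //.
case: mem_sewn_right => // -[i' lt_i /eqP]; rewrite rcorner_eq ?add_be // => /eqP ei.
by move: ni; rewrite ei leq_addl ltn_add2r lt_i.
Qed.

Lemma sew_rv_other x : x \notin p -> rv x \notin p -> srv (O x) = O (rv x).
Proof.
move=> px prx; rewrite /sew_rv.
have -> : (O x \in u) = false.
  apply/negP=> /mem_sewn_left[i lt_i /eqP]; rewrite old_eq => /eqP ex.
  by move: px; rewrite ex mem_nth // size_p ltnS add_al.
rewrite [rv _]slit_rv_other //.
case: mem_sewn_right => // -[i lt_i /eqP].
by rewrite eq_sym rcorner_old ?add_be.
Qed.

Lemma sew_rv_lcorner i : i <= n -> srv (L i.+1) = O (P i).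
Proof.
move=> le_i; rewrite /sew_rv.
case: mem_sewn_left => [[i' _ /eqP]|_]; first by rewrite lcorner_old.
rewrite [rv _]slit_rv_lcorner //.
case: mem_sewn_right => // -[i' lt_i /eqP].
by rewrite eq_sym rcorner_old ?add_be.
Qed.

Lemma sew_rv_rcorner i : i <= n -> srv (R i) = O (rv (P i)).
Proof.
move=> le_i; rewrite /sew_rv.
case: mem_sewn_left => [[i' _ /eqP]|_]; first by rewrite rcorner_old.
rewrite [rv _]slit_rv_rcorner //.
case: mem_sewn_right => // -[i' lt_i /eqP].
by rewrite eq_sym rcorner_old ?add_be.
Qed.

End Sewing.
End SlitSew.

Section NextPrev.
Variables (T : eqType) (d : T) (p : seq T) (n : nat).
Hypotheses (p_uniq : uniq p) (size_p : size p = n.+1).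

Lemma next_nth_lt i : i < n -> next p (nth d p i) = nth d p i.+1.
Proof.
case: p p_uniq size_p => [|x q] // uq [sq] lt_i.
by rewrite next_nth_rcons ?sq ?ltnS ?(ltnW lt_i) // nth_rcons sq lt_i.
Qed.

Lemma next_nth_last : next p (nth d p n) = nth d p 0.
Proof.
case: p p_uniq size_p => [|x q] // uq [sq].
by rewrite next_nth_rcons ?sq // nth_rcons sq ltnn eqxx.
Qed.

Lemma prev_nth_lt i : i < n -> prev p (nth d p i.+1) = nth d p i.
Proof. by move=> lt_i; rewrite -next_nth_lt // prev_next. Qed.

Lemma prev_nth0 : prev p (nth d p 0) = nth d p n.
Proof. by rewrite -next_nth_last prev_next. Qed.

End NextPrev.

(** * The left construction is a slide *)

Section LeftConstruction.
Variables (k : nat) (m : premap k) (c h : m) (p : seq m) (n : nat).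
Hypotheses (rvK : involutive (@rv k m)).
Hypotheses (p_uniq : uniq p) (p_rv : forall x, x \in p -> rv x \notin p).
Hypotheses (size_p : size p = n.+1) (p0 : nth h p 0 = h).
Hypotheses (nxt_h : nxt h != h) (c_h : c != h) (nxt_h_c : nxt h != c).
Hypothesis lab_h : lab h = None.

Variables (j j' : nat).
Hypotheses (jE : j = n + 1) (j'E : j' = n + 0).

Local Notation O := (old p).
Local Notation L := (lcorner h p).
Local Notation R := (rcorner c p).
Local Notation P := (nth h p).
Local Notation sewn := (sewn_lips h c p 2 j 1 j').
Local Notation T := (@Premap k (slit h c p) (sew_rv 2 j 1 j') (sew_nxt 2 1) lab).
Local Notation SM := (sew h c p 2 j 1 j').

Let al_be : 1 + 0 = 1. Proof. by []. Qed.
Let snxt (z : T) : T := nxt z.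

Lemma lsew_nxtE (z : T) : snxt z =
  if slit_nxt h c z == L 1 then R 0
  else if slit_nxt h c z == R 0 then L 1 else slit_nxt h c z.
Proof. by []. Qed.

(** As sewing exchanges [L 1] and [R 0] as successors, the contour that led to [c] runs through
    [L n.+1], ..., [L 2], then [R 0], ..., [R n]. All but the last are sewn, so that only [R n]
    remains in front of [c]. *)
Lemma lsew_chain x i : nxt x = c -> i <= n + n ->
  iter i.+1 snxt (O x) = if i < n then L (n.+1 - i) else R (i - n).
Proof.
move=> nx; elim: i => [_|i IHi lt_i].
  rewrite /= lsew_nxtE (slit_nxt_old _ _ size_p) nx (negPf c_h) eqxx.
  rewrite ?subn0 (lcorner_eq _ size_p) // (lcorner_rcorner _ _ size_p) //.
  by case: (n).
rewrite iterS IHi ?(ltnW lt_i) // lsew_nxtE; case: (ltnP i n) => [lt_in|le_ni].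
  have -> : n.+1 - i = (n - i.+1).+2 by rewrite subnSK // subSn // ltnW.
  have le_s : (n - i.+1).+1 <= n by rewrite subnSK // leq_subr.
  rewrite (slit_nxt_lcorner _ _ size_p) // (lcorner_rcorner _ _ size_p); last exact: ltnW.
  rewrite (lcorner_eq _ size_p) //; last exact: ltnW.
  move: lt_in; rewrite leq_eqVlt => /predU1P[<-|lt_in1].
    by rewrite subnn eqxx ltnn.
  rewrite lt_in1 subSn ?(ltnW lt_in1) //; case: eqP => // /eqP.
  by rewrite subn_eq0 leqNgt lt_in1.
rewrite (slit_nxt_rcorner _ _ size_p); last by rewrite leq_subLR ltnW.
have lt_s : i - n < n by rewrite ltn_subLR.
rewrite eq_sym (lcorner_rcorner _ _ size_p) // (rcorner_eq _ size_p) //=.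
by rewrite ltnNge (leqW le_ni) /= subSn.
Qed.

Let Lsewn i (le_i : i <= n) : (L i.+1 \in sewn) = (1 <= i < n + 1).
Proof. exact: (lcorner_sewn h c p_uniq size_p _ jE j'E). Qed.
Let Rsewn i (le_i : i <= n) : (R i \in sewn) = (0 <= i < n + 0).
Proof. exact: (rcorner_sewn h c p_uniq size_p _ jE j'E). Qed.
Let Osewn x : O x \notin sewn.
Proof. exact: (old_sewn h c p_uniq size_p _ jE j'E). Qed.

Lemma lsew_kept_l : L 1 \notin sewn.
Proof. by rewrite Lsewn. Qed.

Lemma lsew_kept_r : R n \notin sewn.
Proof. by rewrite Rsewn // addn0 ltnn. Qed.

Lemma lsew_skip_c x : nxt x = c -> @skip k T sewn (O x) = R n.
Proof.
move=> nx; have E := lsew_chain nx; rewrite (@skip_iter k T sewn _ (n + n)).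
- by rewrite [LHS]E // ltnNge leq_addr addnK.
- rewrite [#|_|](card_slit h c size_p) addSn !addnS.
  by apply: leq_trans (leq_addl #|m| _) _; rewrite !addnS ltnW.
- move=> i lt_i; rewrite [iter _ _ _]E ?(ltnW lt_i) //; case: ltnP => [lt_in|le_ni].
    rewrite subSn ?(ltnW lt_in) // Lsewn ?leq_subr //.
    by rewrite subn_gt0 lt_in addn1 ltnS leq_subr.
  have lt_s : i - n < n by rewrite ltn_subLR.
  by rewrite Rsewn ?(ltnW lt_s) // addn0.
by rewrite [iter _ _ _]E // ltnNge leq_addr addnK lsew_kept_r.
Qed.

Lemma lsew_skip_h x : nxt x = h -> @skip k T sewn (O x) = L 1.
Proof.
move=> nx; have E : @nxt k T (O x) = L 1.
  rewrite [LHS]lsew_nxtE (slit_nxt_old _ _ size_p) nx eqxx eqxx.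
  by rewrite eq_sym (lcorner_rcorner _ _ size_p).
by rewrite skip1 E // lsew_kept_l.
Qed.

Lemma lsew_skip_old x : nxt x != h -> nxt x != c -> @skip k T sewn (O x) = O (nxt x).
Proof.
move=> nh nc; have E : @nxt k T (O x) = O (nxt x).
  rewrite [LHS]lsew_nxtE (slit_nxt_old _ _ size_p) (negPf nh) (negPf nc).
  by rewrite eq_sym (lcorner_old _ size_p) // eq_sym (rcorner_old _ size_p).
by rewrite skip1 E // Osewn.
Qed.

Lemma lsew_skip_l : @skip k T sewn (L 1) = O h.
Proof.
have E : @nxt k T (L 1) = O h.
  rewrite [LHS]lsew_nxtE (slit_nxt_lcorner _ _ size_p) //.
  by rewrite eq_sym (lcorner_old _ size_p) // eq_sym (rcorner_old _ size_p).
by rewrite skip1 E // Osewn.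
Qed.

Lemma lsew_skip_r : @skip k T sewn (R n) = O c.
Proof.
have E : @nxt k T (R n) = O c.
  rewrite [LHS]lsew_nxtE (slit_nxt_rcorner _ _ size_p) // rcorner_last //.
  by rewrite eq_sym (lcorner_old _ size_p) // eq_sym (rcorner_old _ size_p).
by rewrite skip1 E // Osewn.
Qed.

(** The lip r_l, which is [R n], takes the name [h]. Among the elements that are not sewn, only
    [O h] and [L 1] are missed: they form the dangling edge. *)
Let G0 x : T := if x == h then R n else O x.

Lemma lsew_rv x : @rv k T (G0 x) = G0 (slide_rv p x).
Proof.
have hp : h \in p by have := @mem_nth _ h p 0; rewrite p0 size_p; apply.
have rv_h y : y \in p -> (rv y == h) = false.
  move=> py; apply/negP=> /eqP e1; have := p_rv py.
  by rewrite e1 hp.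
have P_h i : i < n -> (P i.+1 == h) = false.
  move=> lt_i; have : (P i.+1 == P 0) = false by rewrite nth_uniq ?size_p.
  by rewrite p0.
have inP i : i <= n -> P i \in p by move=> le_i; rewrite mem_nth // size_p.
rewrite /G0 /slide_rv; case: (eqVneq x h) => [->|xh].
  have := prev_nth0 h p_uniq size_p; rewrite p0 hp => ->; rewrite rv_h ?inP //.
  exact: (sew_rv_rcorner h c size_p _ jE j'E).
case px: (x \in p).
  case/(nthP h): px => -[|i] lt_i ex; first by move: xh; rewrite -ex p0 eqxx.
  move: lt_i; rewrite -ex size_p ltnS => lt_i.
  rewrite (prev_nth_lt _ p_uniq size_p) // rv_h ?inP ?(ltnW lt_i) //.
  have := sew_rv_path h c p_uniq size_p al_be jE j'E lt_i.
  by rewrite addn1 addn0.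
case prx: (rv x \in p); last first.
  case: eqP => [e1|_]; first by move: prx; rewrite e1 hp.
  by apply: (sew_rv_other h c size_p _ jE j'E); rewrite ?px ?prx.
case/(nthP h): prx => i; rewrite size_p ltnS => le_i ex.
have -> : x = rv (P i) by rewrite ex rvK.
rewrite rvK; move: (le_i); rewrite leq_eqVlt => /predU1P[->|lt_i].
  rewrite (next_nth_last _ p_uniq size_p) p0 eqxx.
  apply: (sew_rv_rev_kept h c rvK p_uniq p_rv size_p _ jE j'E) => //.
  by rewrite addn0 ltnn.
rewrite (next_nth_lt _ p_uniq size_p) // P_h //.
have := sew_rv_rev h c rvK p_uniq p_rv size_p al_be jE j'E lt_i.
by rewrite addn1 addn0.
Qed.

Lemma lsew_G0_kept x : G0 x \notin sewn.
Proof. by rewrite /G0; case: ifP => _; [apply: lsew_kept_r | apply: Osewn]. Qed.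

Lemma left_construction (dK : O h \notin sewn) (hK : R n \notin sewn) :
  exists2 y, @delete_dangling k SM (Sub (O h) dK) (Sub (R n) hK) = Some y &
             iso y (slide p c h).
Proof.
pose G (x : slide_map p c h) : SM := Sub (G0 x) (lsew_G0_kept x).
have GE x : val (G x) = G0 x by [].
pose d : SM := Sub (O h) dK; have dE : val d = O h by [].
have rvE (w : SM) z : @rv k T (val w) = z -> z \notin sewn -> val (rv w) = z.
  by move=> <- nz; apply: val_remove_rv.
have nxtE (w : SM) z : @skip k T sewn (val w) = z -> z \notin sewn -> val (nxt w) = z.
  by move=> <- nz; apply: val_remove_nxt.
have rdE : val (rv d) = L 1.
  apply: rvE lsew_kept_l; rewrite dE.
  have := sew_rv_path_kept h c p_uniq size_p al_be jE j'E (leq0n n).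
  by rewrite p0; apply.
have G0d x : (G0 x == O h) = false.
  by rewrite /G0; case: ifP => [_|//]; rewrite (rcorner_old _ size_p).
have G0r x : (G0 x == L 1) = false.
  rewrite /G0 eq_sym; case: ifP => _; first exact: (lcorner_rcorner _ _ size_p).
  exact: (lcorner_old _ size_p).
have GN x : G x \notin [:: d; rv d].
  by rewrite !inE -!(inj_eq val_inj) dE rdE G0d G0r.
have Gh : G h = Sub (R n) hK.
  by apply: val_inj; rewrite /= /G0 eqxx.
rewrite -Gh -/d; apply: (@delete_iso k SM (slide_map p c h) (@nxt k m h) h d G) => //.
- move=> x y /(congr1 val); rewrite !GE /G0.
  case: (eqVneq x h) => [->|xh]; case: (eqVneq y h) => [->|yh] //; last by case.
    by move/eqP; rewrite (rcorner_old _ size_p).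
  by move/esym/eqP; rewrite (rcorner_old _ size_p).
- move=> z; rewrite !inE -!(inj_eq val_inj) dE rdE negb_or => /andP[zd zr].
  have zs := valP z.
  have [[x ex]|[i le_i ei]|[i le_i ei]] := slit_cases (e := h) (f := c) size_p (val z).
  + exists x; apply: val_inj; rewrite ex GE /G0; case: eqP => // xh.
    by move: zd; rewrite ex xh eqxx.
  + move: zs zr; rewrite ei /= Lsewn // addn1 ltnS le_i andbT -eqn0Ngt => /eqP->.
    by rewrite eqxx.
  exists h; apply: val_inj; rewrite Gh ei /=; congr (R _); apply/eqP.
  by move: zs; rewrite ei /= Rsewn // addn0 -leqNgt => le_n; rewrite eqn_leq le_i.
- move=> x; apply: val_inj; symmetry; apply: rvE; last exact: lsew_G0_kept.
  exact: lsew_rv.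
- suff skipG (x : m) : skip [:: d; rv d] (G x) = G (slide_nxt c h x).
    by move=> x; apply: skipG.
  rewrite /slide_nxt.
  have nxt_d : val (nxt d) = O (nxt h).
    by apply: nxtE; rewrite ?Osewn // lsew_skip_old.
  have nxt_rd : nxt (rv d) = d.
    by apply: val_inj; apply: nxtE; rewrite ?Osewn // rdE lsew_skip_l.
  case: (eqVneq x h) => [->|xh].
    have E : nxt (G h) = G c.
      apply: val_inj; apply: nxtE; last exact: lsew_G0_kept.
      by rewrite /= /G0 eqxx (negPf c_h) lsew_skip_r.
    by rewrite skip1 E // GN.
  have GxE : val (G x) = O x by rewrite GE /G0 (negPf xh).
  case: (eqVneq (nxt x) h) => [nx|nxh].
    have E1 : nxt (G x) = rv d.
      by apply: val_inj; rewrite rdE; apply: nxtE lsew_kept_l; rewrite GxE lsew_skip_h.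
    have E2 : nxt d = G (nxt h).
      by apply: val_inj; rewrite nxt_d GE /G0 (negPf nxt_h).
    apply: (skip3 _ _ _ _ E1 nxt_rd E2); rewrite ?GN ?inE ?eqxx ?orbT //=.
    have := GN x; rewrite !inE negb_or => /andP[/negPf-> /negPf->].
    by rewrite -(inj_eq val_inj) rdE dE (lcorner_old _ size_p).
  case: (eqVneq (nxt x) c) => [nx|nxc].
    have E1 : nxt (G x) = G h.
      apply: val_inj; apply: nxtE; last exact: lsew_G0_kept.
      by rewrite GxE lsew_skip_c //= /G0 eqxx.
    by rewrite skip1 E1 // GN.
  have E1 : nxt (G x) = G (nxt x).
    apply: val_inj; apply: nxtE; last exact: lsew_G0_kept.
    by rewrite GxE lsew_skip_old //= /G0 (negPf nxh).
  by rewrite skip1 E1 // GN.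
- move=> x; rewrite /= /G0; case: (eqVneq x h) => [->|//].
  have lt_n : n < size p by rewrite size_p.
  by rewrite (rcornerE _ lt_n) lab_h.
- rewrite /dangling /half_edge -(inj_eq val_inj) rdE dE (lcorner_old _ size_p) //=.
  by apply/eqP/val_inj; apply: nxtE; rewrite ?Osewn // rdE lsew_skip_l.
apply: val_inj; apply: nxtE; last exact: lsew_G0_kept.
by rewrite /= /G0 (negPf nxt_h) lsew_skip_old.
Qed.

End LeftConstruction.

(** * The right construction is a slide *)

Section RightConstruction.
Variables (k : nat) (m : premap k) (c h : m) (p : seq m) (n : nat).
Hypotheses (rvK : involutive (@rv k m)) (nxt_inj : injective (@nxt k m)).
Hypotheses (p_uniq : uniq p) (p_rv : forall x, x \in p -> rv x \notin p).
Hypotheses (size_p : size p = n.+1) (p0 : nth (nxt h) p 0 = rv h).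
Hypotheses (nxt_h : nxt h != h) (c_h : c != h) (nxt_h_c : nxt h != c).
Hypothesis lab_h : lab h = None.

Variables (j j' : nat).
Hypotheses (jE : j = n + 0) (j'E : j' = n + 1).

Local Notation e := (nxt h).
Local Notation O := (old p).
Local Notation L := (lcorner (nxt h) p).
Local Notation R := (rcorner c p).
Local Notation P := (nth (nxt h) p).
Local Notation sewn := (sewn_lips (nxt h) c p 1 j 2 j').
Local Notation T := (@Premap k (slit (nxt h) c p) (sew_rv 1 j 2 j') (sew_nxt 1 2) lab).
Local Notation SM := (sew (nxt h) c p 1 j 2 j').

Let al_be : 0 + 1 = 1. Proof. by []. Qed.
Let snxt (z : T) : T := nxt z.

Lemma rsew_nxtE (z : T) : snxt z =
  if slit_nxt e c z == O e then R 1
  else if slit_nxt e c z == R 1 then O e else slit_nxt e c z.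
Proof. by []. Qed.

Lemma rcorner_neq_start i : i <= n.+1 -> (R i == O e) = false.
Proof.
rewrite leq_eqVlt => /predU1P[->|le_i]; last exact: (rcorner_old _ size_p).
by rewrite (rcorner_last _ size_p) old_eq eq_sym (negPf nxt_h_c).
Qed.

(** For a path of length one, [R 1] is not a lip but the exit corner [c], hence a separate case. *)
Lemma rcorner_neq1 i : i != 1 -> i <= n.+1 -> (R i == R 1) = false.
Proof.
move=> i1; rewrite leq_eqVlt => /predU1P[ei|le_i].
  move: i1; rewrite ei eqSS -lt0n (rcorner_last _ size_p) => n_gt0.
  by rewrite eq_sym (rcorner_old _ size_p).
case: (posnP n) => [n0|n_gt0]; last by rewrite (rcorner_eq _ size_p) // (negPf i1).
have -> : R 1 = O c by rewrite -(rcorner_last _ size_p) n0.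
exact: (rcorner_old _ size_p).
Qed.

(** After the lip [L n.+1], which is kept, the contour runs through [L n], ..., [L 1], then, by the
    exchange of [O e] and [R 1], through [R 1], ..., [R n]. All these are sewn, and the next element
    [R n.+1] is the corner [c]. *)
Lemma rsew_chain i : i <= n + n ->
  iter i.+1 snxt (L n.+1) = if i < n then L (n - i) else R (i - n).+1.
Proof.
elim: i => [_|i IHi lt_i].
  rewrite /= rsew_nxtE (slit_nxt_lcorner _ _ size_p) // subn0.
  case: (posnP n) => [->|n_gt0]; first by rewrite eqxx.
  rewrite -(prednK n_gt0) (lcorner_old _ size_p) ?(lcorner_rcorner _ _ size_p) //;
  exact: leq_pred.
rewrite iterS IHi ?(ltnW lt_i) // rsew_nxtE; case: (ltnP i n) => [lt_in|le_ni].
  have -> : n - i = (n - i.+1).+1 by rewrite subnSK.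
  rewrite (slit_nxt_lcorner _ _ size_p) ?leq_subr //.
  move: lt_in; rewrite leq_eqVlt => /predU1P[<-|lt_in1].
    by rewrite subnn eqxx ltnn.
  have -> : n - i.+1 = (n - i.+2).+1 by rewrite subnSK.
  by rewrite lt_in1 (lcorner_old _ size_p) ?(lcorner_rcorner _ _ size_p) ?leq_subr.
have lt_s : i - n < n by rewrite ltn_subLR.
rewrite (slit_nxt_rcorner _ _ size_p) // rcorner_neq_start // rcorner_neq1 //.
by rewrite ltnNge (leqW le_ni) /= subSn.
Qed.

Let Lsewn i (le_i : i <= n) : (L i.+1 \in sewn) = (0 <= i < n + 0).
Proof. exact: (lcorner_sewn e c p_uniq size_p _ jE j'E). Qed.
Let Rsewn i (le_i : i <= n) : (R i \in sewn) = (1 <= i < n + 1).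
Proof. exact: (rcorner_sewn e c p_uniq size_p _ jE j'E). Qed.
Let Osewn x : O x \notin sewn.
Proof. exact: (old_sewn e c p_uniq size_p _ jE j'E). Qed.

Lemma rsew_kept_r : R 0 \notin sewn.
Proof. by rewrite Rsewn. Qed.

Lemma rsew_kept_l : L n.+1 \notin sewn.
Proof. by rewrite Lsewn // addn0 ltnn. Qed.

Lemma rsew_skip_l : @skip k T sewn (L n.+1) = O c.
Proof.
have E := rsew_chain; rewrite (@skip_iter k T sewn _ (n + n)).
- by rewrite [LHS]E // ltnNge leq_addr addnK (rcorner_last _ size_p).
- rewrite [#|_|](card_slit e c size_p) addSn !addnS.
  by apply: leq_trans (leq_addl #|m| _) _; rewrite !addnS ltnW.
- move=> i lt_i; rewrite [iter _ _ _]E ?(ltnW lt_i) //; case: ltnP => [lt_in|le_ni].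
    have -> : n - i = (n - i.+1).+1 by rewrite subnSK.
    by rewrite Lsewn ?leq_subr // addn0 ltn_subrL (leq_ltn_trans _ lt_in).
  have lt_s : i - n < n by rewrite ltn_subLR.
  by rewrite Rsewn // addn1 ltnS.
by rewrite [iter _ _ _]E // ltnNge leq_addr addnK (rcorner_last _ size_p) Osewn.
Qed.

Lemma rsew_skip_h : @skip k T sewn (O h) = R 0.
Proof.
have E : @nxt k T (O h) = R 0.
  rewrite [LHS]rsew_nxtE (slit_nxt_old _ _ size_p) eqxx rcorner_neq_start //.
  by rewrite rcorner_neq1.
by rewrite skip1 E // rsew_kept_r.
Qed.

Lemma rsew_skip_c x : nxt x = c -> @skip k T sewn (O x) = L n.+1.
Proof.
have ce : (c == e) = false by rewrite eq_sym (negPf nxt_h_c).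
move=> nx; have E : @nxt k T (O x) = L n.+1.
  rewrite [LHS]rsew_nxtE (slit_nxt_old _ _ size_p) nx ce eqxx.
  by rewrite (lcorner_old _ size_p) // (lcorner_rcorner _ _ size_p).
by rewrite skip1 E // rsew_kept_l.
Qed.

Lemma rsew_skip_old x : x != h -> nxt x != c -> @skip k T sewn (O x) = O (nxt x).
Proof.
move=> xh nc; have nh : nxt x != e by rewrite (inj_eq nxt_inj).
have E : @nxt k T (O x) = O (nxt x).
  rewrite [LHS]rsew_nxtE (slit_nxt_old _ _ size_p) (negPf nh) (negPf nc).
  rewrite old_eq (negPf nh); case: (posnP n) => [n0|n_gt0].
    have -> : R 1 = O c by rewrite -(rcorner_last _ size_p) n0.
    by rewrite old_eq (negPf nc).
  by rewrite eq_sym (rcorner_old _ size_p).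
by rewrite skip1 E // Osewn.
Qed.

Lemma rsew_skip_r : @skip k T sewn (R 0) = O e.
Proof.
have E : @nxt k T (R 0) = O e.
  rewrite [LHS]rsew_nxtE (slit_nxt_rcorner _ _ size_p) // rcorner_neq_start //.
  by rewrite eqxx.
by rewrite skip1 E // Osewn.
Qed.

(** Here rev(l_l), which is [L n.+1], takes the name [h], and the dangling edge consists of [R 0]
    and [O h]. *)
Let G0 x : T := if x == h then L n.+1 else O x.

Lemma rsew_rv x : @rv k T (G0 x) = G0 (slide_rv (rev p) x).
Proof.
have inP i : i <= n -> P i \in p by move=> le_i; rewrite mem_nth // size_p.
have hE : h = rv (P 0) by rewrite p0 rvK.
have hp : h \notin p by rewrite hE p_rv // inP.
have P_h i : i <= n -> (P i == h) = false.
  by move=> le_i; apply/negP=> /eqP e1; move: hp; rewrite -e1 inP.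
have rP_h i : i < n -> (rv (P i.+1) == h) = false.
  move=> lt_i; apply/negP=> /eqP e1.
  have /eqP : P i.+1 = P 0 by apply: (can_inj rvK); rewrite e1 p0 rvK.
  by rewrite nth_uniq ?size_p.
rewrite /G0 /slide_rv !mem_rev prev_rev // next_rev //.
case: (eqVneq x h) => [->|xh].
  rewrite (negPf hp) -p0 inP // (prev_nth0 _ p_uniq size_p) P_h //.
  exact: (sew_rv_lcorner e c size_p _ jE j'E).
case px: (x \in p).
  case/(nthP e): px => i; rewrite size_p ltnS => le_i <-.
  move: (le_i); rewrite leq_eqVlt => /predU1P[->|lt_i].
    rewrite (next_nth_last _ p_uniq size_p) -hE eqxx.
    by apply: (sew_rv_path_kept e c p_uniq size_p _ jE j'E); rewrite ?addn0 ?ltnn.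
  rewrite (next_nth_lt _ p_uniq size_p) // rP_h //.
  have := sew_rv_path e c p_uniq size_p al_be jE j'E lt_i.
  by rewrite addn1 addn0.
case prx: (rv x \in p); last first.
  case: eqP => [e1|_].
    by move: px; rewrite -(rvK x) e1 -p0 inP.
  by apply: (sew_rv_other e c size_p _ jE j'E); rewrite ?px ?prx.
case/(nthP e): prx => -[|i]; rewrite size_p ltnS => lt_i ex.
  by move: xh; rewrite hE ex rvK eqxx.
have -> : x = rv (P i.+1) by rewrite ex rvK.
rewrite rvK (prev_nth_lt _ p_uniq size_p) // P_h ?(ltnW lt_i) //.
have := sew_rv_rev e c rvK p_uniq p_rv size_p al_be jE j'E lt_i.
by rewrite addn1 addn0.
Qed.

Lemma rsew_G0_kept x : G0 x \notin sewn.
Proof. by rewrite /G0; case: ifP => _; [apply: rsew_kept_l | apply: Osewn]. Qed.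

Lemma right_construction (dK : R 0 \notin sewn) (hK : L n.+1 \notin sewn) :
  exists2 y, @delete_dangling k SM (Sub (R 0) dK) (Sub (L n.+1) hK) = Some y &
             iso y (slide (rev p) c h).
Proof.
pose G (x : slide_map (rev p) c h) : SM := Sub (G0 x) (rsew_G0_kept x).
have GE x : val (G x) = G0 x by [].
pose d : SM := Sub (R 0) dK; have dE : val d = R 0 by [].
have rvE (w : SM) z : @rv k T (val w) = z -> z \notin sewn -> val (rv w) = z.
  by move=> <- nz; apply: val_remove_rv.
have nxtE (w : SM) z : @skip k T sewn (val w) = z -> z \notin sewn -> val (nxt w) = z.
  by move=> <- nz; apply: val_remove_nxt.
have rdE : val (rv d) = O h.
  apply: rvE (Osewn h); rewrite dE -[X in O X]rvK -p0.
  exact: (sew_rv_rcorner e c size_p _ jE j'E).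
have G0d x : (G0 x == R 0) = false.
  rewrite /G0; case: ifP => _; first exact: (lcorner_rcorner _ _ size_p).
  by rewrite eq_sym (rcorner_old _ size_p).
have G0r x : (G0 x == O h) = false.
  by rewrite /G0; case: ifP => [_|//]; rewrite (lcorner_old _ size_p).
have GN x : G x \notin [:: d; rv d].
  by rewrite !inE -!(inj_eq val_inj) dE rdE G0d G0r.
have Gh : G h = Sub (L n.+1) hK.
  by apply: val_inj; rewrite /= /G0 eqxx.
have nxt_d : nxt d = G e.
  apply: val_inj; rewrite GE /G0 (negPf nxt_h); apply: nxtE (Osewn _).
  exact: rsew_skip_r.
have nxt_rd : nxt (rv d) = d.
  by apply: val_inj; apply: nxtE; rewrite ?dE ?rdE ?rsew_skip_h ?rsew_kept_r.
rewrite -Gh -/d.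
apply: (@delete_iso k SM (slide_map (rev p) c h) (@nxt k m h) h d G) => //.
- move=> x y /(congr1 val); rewrite !GE /G0.
  case: (eqVneq x h) => [->|xh]; case: (eqVneq y h) => [->|yh] //; last by case.
    by move/eqP; rewrite (lcorner_old _ size_p).
  by move/esym/eqP; rewrite (lcorner_old _ size_p).
- move=> z; rewrite !inE -!(inj_eq val_inj) dE rdE negb_or => /andP[zd zr].
  have zs := valP z.
  have [[x ex]|[i le_i ei]|[i le_i ei]] := slit_cases (e := e) (f := c) size_p (val z).
  + exists x; apply: val_inj; rewrite ex GE /G0; case: eqP => // xh.
    by move: zr; rewrite ex xh eqxx.
  + exists h; apply: val_inj; rewrite Gh ei /=; congr (L _.+1); apply/eqP.
    by move: zs; rewrite ei /= Lsewn // addn0 -leqNgt => le_n; rewrite eqn_leq le_i.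
  move: zs zd; rewrite ei /= Rsewn // addn1 ltnS le_i andbT -eqn0Ngt => /eqP->.
  by rewrite eqxx.
- move=> x; apply: val_inj; symmetry; apply: rvE; last exact: rsew_G0_kept.
  exact: rsew_rv.
- suff skipG (x : m) : skip [:: d; rv d] (G x) = G (slide_nxt c h x).
    by move=> x; apply: skipG.
  rewrite /slide_nxt; case: (eqVneq x h) => [->|xh].
    have E : nxt (G h) = G c.
      apply: val_inj; apply: nxtE; last exact: rsew_G0_kept.
      by rewrite /= /G0 eqxx (negPf c_h) rsew_skip_l.
    by rewrite skip1 E // GN.
  have GxE : val (G x) = O x by rewrite GE /G0 (negPf xh).
  case: (eqVneq (nxt x) h) => [nx|nxh].
    have E1 : nxt (G x) = rv d.
      apply: val_inj; rewrite rdE; apply: nxtE (Osewn h).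
      by rewrite GxE rsew_skip_old // nx // eq_sym.
    apply: (skip3 _ _ _ _ E1 nxt_rd nxt_d); rewrite ?GN ?inE ?eqxx ?orbT //=.
    have := GN x; rewrite !inE negb_or => /andP[/negPf-> /negPf->].
    by rewrite -(inj_eq val_inj) rdE dE eq_sym (rcorner_old _ size_p).
  case: (eqVneq (nxt x) c) => [nx|nxc].
    have E1 : nxt (G x) = G h.
      apply: val_inj; apply: nxtE; last exact: rsew_G0_kept.
      by rewrite GxE rsew_skip_c //= /G0 eqxx.
    by rewrite skip1 E1 // GN.
  have E1 : nxt (G x) = G (nxt x).
    apply: val_inj; apply: nxtE; last exact: rsew_G0_kept.
    by rewrite GxE rsew_skip_old //= /G0 (negPf nxh).
  by rewrite skip1 E1 // GN.
- move=> x; rewrite /= /G0; case: (eqVneq x h) => [->|//].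
  have lt_n : n < size p by rewrite size_p.
  by rewrite (lcornerS _ lt_n) lab_h.
apply/andP; split; last by rewrite /cw nxt_rd.
by rewrite /half_edge -(inj_eq val_inj) rdE dE eq_sym (rcorner_old _ size_p).
Qed.

End RightConstruction.

(** * The partial constructions succeed and agree with the slides *)

Section Constructions.
Variables (k : nat) (i0 i1 : 'I_k) (a : 'I_k -> nat).
Hypothesis i01 : i0 != i1.

Lemma Phi_left_slide (x : triple k) : slidable i0 i1 a x ->
  exists2 y, Phi_left x = Some y & iso y (slide_left x).
Proof.
move=> [m_map c_in /andP[h_in h_half] h_toward].
have rvK := is_map_rvK m_map; have nI := is_map_nxt_inj m_map.
have conn := is_map_connected m_map.
have h_c := face_h_c m_map i01 c_in h_in.
have nh := face_nxt_h m_map h_in h_half.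
rewrite /Phi_left /slide_left.
set c := tcorner x in c_in h_toward h_c *.
set h := thedge x in h_in h_half h_toward h_c nh *.
have gp := leftmost_geodesic rvK nI conn h c.
have [q pE] := leftmost_head rvK nI conn h_half h_toward.
have -> : slittable h c (leftmost h c).
  rewrite /slittable (geodesic_self_avoiding rvK nI conn gp) andbT.
  by have /andP[-> _] := gp; rewrite pE.
have p_uniq := geodesic_uniq rvK nI conn gp.
have p_rv := geodesic_rv rvK nI conn gp.
have size_p : size (leftmost h c) = (size q).+1 by rewrite pE.
have p0 : nth h (leftmost h c) 0 = h by rewrite pE.
have cNh : c != h by apply: contraNneq h_c => ->; apply: connect0.
have nhNc : nxt h != c by apply: contraNneq h_c => <-; apply: fconnect1.
move: (leftmost h c) gp pE p_uniq p_rv size_p p0 => p gp pE p_uniq p_rv size_p p0.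
have jE : size p = size q + 1 by rewrite addn1.
have j'E : size p - 1 = size q + 0 by rewrite size_p subn1 addn0.
have hL := lab_h m_map h_half.
have construct :=
  left_construction rvK p_uniq p_rv size_p p0 nh cNh nhNc hL jE j'E.
have -> : head (old p h) (left_copy h c p) = old p h by rewrite pE.
have -> : last (old p h) (right_copy h c p) = rcorner c p (size q).
  rewrite -nth_last size_map size_enum_ord.
  have -> : (size p).-1 = size q by rewrite size_p.
  exact: (nth_right_copy size_p).
have dK : old p h \notin sewn_lips h c p 2 (size p) 1 (size p - 1).
  exact: (old_sewn h c p_uniq size_p (erefl : 1 + 0 = 1) jE j'E).
have hK : rcorner c p (size q) \notin sewn_lips h c p 2 (size p) 1 (size p - 1).
  by rewrite (rcorner_sewn h c p_uniq size_p (erefl : 1 + 0 = 1) jE j'E) // addn0 ltnn.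
rewrite (insubT (fun z => z \notin _) dK) (insubT (fun z => z \notin _) hK).
exact: construct.
Qed.

Lemma Phi_right_slide (x : triple k) : coslidable i0 i1 a x ->
  exists2 y, Phi_right x = Some y & iso y (slide_right x).
Proof.
move=> [m_map c_in /andP[h_in h_half] h_away].
have rvK := is_map_rvK m_map; have nI := is_map_nxt_inj m_map.
have conn := is_map_connected m_map.
have h_c : ~~ fconnect nxt (thedge x) (tcorner x).
  by rewrite (fconnect_sym nI); apply: (face_h_c m_map i01 h_in c_in).
have nh := face_nxt_h m_map h_in h_half.
rewrite /Phi_right /slide_right.
set c := tcorner x in c_in h_away h_c *.
set h := thedge x in h_in h_half h_away h_c nh *.
have gp := rightmost_geodesic rvK nI conn (nxt h) c.
have [q pE] := rightmost_head rvK nI conn h_half h_away.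
have -> : slittable (nxt h) c (rightmost (nxt h) c).
  rewrite /slittable (geodesic_self_avoiding rvK nI conn gp) andbT.
  by have /andP[-> _] := gp; rewrite pE.
have p_uniq := geodesic_uniq rvK nI conn gp.
have p_rv := geodesic_rv rvK nI conn gp.
have size_p : size (rightmost (nxt h) c) = (size q).+1 by rewrite pE.
have p0 : nth (nxt h) (rightmost (nxt h) c) 0 = rv h by rewrite pE.
have cNh : c != h by apply: contraNneq h_c => ->; apply: connect0.
have nhNc : nxt h != c by apply: contraNneq h_c => <-; apply: fconnect1.
move: (rightmost (nxt h) c) gp pE p_uniq p_rv size_p p0.
move=> p gp pE p_uniq p_rv size_p p0.
have jE : size p - 1 = size q + 0 by rewrite size_p subn1 addn0.
have j'E : size p = size q + 1 by rewrite addn1.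
have hL := lab_h m_map h_half.
have construct :=
  right_construction rvK nI p_uniq p_rv size_p p0 nh cNh nhNc hL jE j'E.
have -> : head (old p h) (right_copy (nxt h) c p) = rcorner c p 0.
  by rewrite -nth0 (nth_right_copy size_p).
have -> : head (old p h) (Defs.rev_path (left_copy (nxt h) c p)) =
          lcorner (nxt h) p (size q).+1.
  rewrite /Defs.rev_path -nth0 nth_rev !size_map size_p // subn1 /=.
  rewrite (nth_map (old p h)) ?size_map ?size_p // (nth_map (nxt h)) ?size_p //.
  exact: (slit_rv_path (nxt h) p_uniq size_p).
have dK : rcorner c p 0 \notin sewn_lips (nxt h) c p 1 (size p - 1) 2 (size p).
  by rewrite (rcorner_sewn (nxt h) c p_uniq size_p (erefl : 0 + 1 = 1) jE j'E).
have hK : lcorner (nxt h) p (size q).+1 \notin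
    sewn_lips (nxt h) c p 1 (size p - 1) 2 (size p).
  rewrite (lcorner_sewn (nxt h) c p_uniq size_p (erefl : 0 + 1 = 1) jE j'E) //.
  by rewrite addn0 ltnn.
rewrite (insubT (fun z => z \notin _) dK) (insubT (fun z => z \notin _) hK).
exact: construct.
Qed.

End Constructions.

(** Positivity of [a i1] makes the truncated subtraction reversible. *)
Lemma slid_degreeK k (i0 i1 : 'I_k) (a : 'I_k -> nat) i : i0 != i1 -> 0 < a i1 ->
  slid_degree i1 i0 (slid_degree i0 i1 a) i = a i.
Proof.
move=> i01 a1; rewrite /slid_degree; case: (eqVneq i i1) => [->|_].
  by rewrite eq_sym (negPf i01) subnK.
by case: (eqVneq i i0) => //= _; rewrite addnK.
Qed.

Lemma eq_slidable k (i0 i1 : 'I_k) (a b : 'I_k -> nat) x : a =1 b ->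
  slidable i0 i1 a x -> slidable i0 i1 b x.
Proof.
move=> ab [[m1 m2 m3 m4 deg] c_in h_in h_toward]; split=> //; split=> // i.
by rewrite deg ab.
Qed.

Theorem theorem6 (r : nat) (a : 'I_r.+1 -> nat)
    (r_ge1 : 1 <= r)
    (a_pos : forall i, 0 < a i)
    (a_last : 2 <= a ord_max)
    (a_parity : (forall i, ~~ odd (a i)) \/
                (odd (a ord_max) /\ #|[set i | odd (a i)]| = 2)) :
  [/\ well_defined (M_left a) (M_right a) (@Phi_left r.+1),
      well_defined (M_right a) (M_left a) (@Phi_right r.+1),
      inverse_on (M_left a) (@Phi_left r.+1) (@Phi_right r.+1) &
      inverse_on (M_right a) (@Phi_right r.+1) (@Phi_left r.+1)].
Proof.
(* As r >= 1, the faces f_1 and f_{r+1} are distinct. *)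
have i01 : ord0 != ord_max :> 'I_r.+1 by rewrite -val_eqE /= eq_sym -lt0n.
have left_ok x : M_left a x -> exists2 y,
    Phi_left x = Some y & M_right a y /\ iso y (slide_left x).
  move=> x_ok; have [y yE y_iso] := Phi_left_slide i01 x_ok; exists y => //.
  split=> //; exact: iso_coslidable (iso_sym y_iso) (slide_left_coslidable i01 x_ok).
have right_ok x : M_right a x -> exists2 y,
    Phi_right x = Some y & M_left a y /\ iso y (slide_right x).
  move=> x_ok; have [y yE y_iso] := Phi_right_slide i01 x_ok; exists y => //.
  split=> //; apply: (iso_slidable (iso_sym y_iso)).
  apply: eq_slidable (slide_right_slidable i01 x_ok) => i; exact: slid_degreeK.
split.
(* Any value is isomorphic to the slide, and the slide respects isomorphisms. *)
- split=> [x /left_ok[y yE []] | x x' y y' Px Px' xx' xy xy']; first by exists y.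
  have [y_1 + [_ y_iso]] := left_ok x Px; rewrite xy => -[e_y]; subst y_1.
  have [y'_1 + [_ y'_iso]] := left_ok x' Px'; rewrite xy' => -[e_y']; subst y'_1.
  have [m_map _ _ _] := Px.
  exact: iso_trans y_iso (iso_trans (iso_slide_left m_map xx') (iso_sym y'_iso)).
- split=> [x /right_ok[y yE []] | x x' y y' Px Px' xx' xy xy']; first by exists y.
  have [y_1 + [_ y_iso]] := right_ok x Px; rewrite xy => -[e_y]; subst y_1.
  have [y'_1 + [_ y'_iso]] := right_ok x' Px'; rewrite xy' => -[e_y']; subst y'_1.
  have [m_map _ _ _] := Px.
  exact: iso_trans y_iso (iso_trans (iso_slide_right m_map xx') (iso_sym y'_iso)).
- move=> x Px; have [y yE [Py y_iso]] := left_ok x Px.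
  have [x' x'E [_ x'_iso]] := right_ok y Py; exists y, x' => //.
  (* As [y] is only isomorphic to [slide_left x], the isomorphism is carried through [slide_right]
     before the two slides cancel. *)
  have [m_map _ _ _] := Py; apply: iso_trans x'_iso _.
  exact: iso_trans (iso_slide_right m_map y_iso) (slide_leftK i01 Px).
move=> x Px; have [y yE [Py y_iso]] := right_ok x Px.
have [x' x'E [_ x'_iso]] := left_ok y Py; exists y, x' => //.
have [m_map _ _ _] := Py; apply: iso_trans x'_iso _.
exact: iso_trans (iso_slide_left m_map y_iso) (slide_rightK i01 Px).
Qed.
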